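(* Let $X$ be a Banach space as described in the context, and assume that the finite limit $\mu=\lim_{n\to\infty}\|z^n\|^{1/n}$ exists. Let $f\in X$ and $\rho,\sigma\in(0,\infty)$. Then $f$ is (the restriction to $\mathbb{D}$ of) an entire function of finite order $\rho$ and normal type $\sigma$ if and only if $$\limsup_{n\to\infty}\frac{n}{e\rho}\left(\frac{E_n(f)}{\|z^n\|}\right)^{\rho/n}=\sigma .$$
   Context: $\mathbb{D}=\{z\in\mathbb{C}:|z|<1\}$. $X$ is a complex Banach space of functions analytic in $\mathbb{D}$ whose norm $\|\cdot\|$ satisfies: (i) $\|f(\cdot\, e^{it})\|=\|f(\cdot)\|$ for all $t\in\mathbb{R}$ and $f\in X$; (ii) $\|f\|<\infty$ for every entire function $f$; (iii) for all $f\in X$ and $g\in L[0,2\pi]$, $\big\|\frac{1}{2\pi}\int_0^{2\pi} f(ze^{it})g(t)\,dt\big\|\le \frac{1}{2\pi}\int_0^{2\pi}|g(t)|\,dt\cdot\|f\|$. For $n\ge 1$, $\mathcal{P}_n$ is the set of complex polynomials of degree at most $n-1$, $E_n(f)=\inf_{p\in\mathcal{P}_n}\|f-p\|$, and $\|z^n\|$ is the norm in $X$ of the monomial $z\mapsto z^n$. For an entire function $F$ with $M(r)=\max_{|z|=r}|F(z)|$, its order is $\rho=\limsup_{r\to\infty}\frac{\ln\ln M(r)}{\ln r}$ and, when $0<\rho<\infty$, its type is $\limsup_{r\to\infty}\frac{\ln M(r)}{r^\rho}$; normal type means the type lies in $(0,\infty)$. *)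

(* Defs.v *)
From HB Require Import structures.
From mathcomp Require Import all_boot all_order all_algebra.
From mathcomp Require Import all_classical all_reals all_analysis.
From mathcomp Require Import complex.
Set Implicit Arguments. Unset Strict Implicit. Unset Printing Implicit Defensive.
Import Order.TTheory GRing.Theory Num.Theory.
Import numFieldNormedType.Exports.
Local Open Scope classical_set_scope.
Local Open Scope ring_scope.

Section Defs.
Variable R : realType.
Local Notation C := (R[i]).

Definition cabs (z : C) : R := ComplexField.Normc.normc z.

Definition expi (t : R) : C := (cos t +i* sin t)%C.

Definition disc : set C := [set z | cabs z < 1].

Definition ccvg (u : nat -> C) (w : C) : Prop :=
  forall e : R, 0 < e -> exists N : nat, forall n, (N <= n)%N -> cabs (u n - w) < e.

Definition pseries_to (a : nat -> C) (z0 z w : C) : Prop :=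
  ccvg (fun n => \sum_(k < n) a k * (z - z0) ^+ k) w.

Definition analytic_on (U : set C) (F : C -> C) : Prop :=
  forall z0, U z0 -> exists r : R, 0 < r /\ exists a : nat -> C,
    forall z, cabs (z - z0) < r -> U z -> pseries_to a z0 z (F z).

Definition entire (F : C -> C) : Prop := analytic_on setT F.

Definition cint02pi (h : R -> C) : C :=
  (Rintegral lebesgue_measure `[0, pi *+ 2]%classic (fun t => complex.Re (h t))
   +i* Rintegral lebesgue_measure `[0, pi *+ 2]%classic (fun t => complex.Im (h t)))%C.

Definition L1_02pi (g : R -> C) : Prop :=
  lebesgue_measure.-integrable `[0, pi *+ 2]%classic (fun t => (complex.Re (g t))%:E) /\
  lebesgue_measure.-integrable `[0, pi *+ 2]%classic (fun t => (complex.Im (g t))%:E).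

(* The standing assumptions on (X, ||.||): X is a set of functions
   (identified when they agree on D) analytic in D, which is a complex
   Banach space for the pointwise operations with norm Xn, and which
   satisfies (i), (ii), (iii). *)
Definition admissible_space (X : set (C -> C)) (Xn : (C -> C) -> R) : Prop :=
  (forall f, X f -> analytic_on disc f) /\
  (* elements of X are functions on D *)
  (forall f g, X f -> (forall z, disc z -> f z = g z) -> X g /\ Xn g = Xn f) /\
  X (fun _ => 0) /\
  (forall f g, X f -> X g -> X (fun z => f z + g z)) /\
  (forall (c : C) f, X f -> X (fun z => c * f z)) /\
  (forall f, X f -> 0 <= Xn f) /\
  (forall f, X f -> (Xn f = 0 <-> forall z, disc z -> f z = 0)) /\
  (forall (c : C) f, X f -> Xn (fun z => c * f z) = cabs c * Xn f) /\
  (forall f g, X f -> X g -> Xn (fun z => f z + g z) <= Xn f + Xn g) /\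
  (forall u : nat -> C -> C, (forall n, X (u n)) ->
     (forall e : R, 0 < e -> exists M : nat, forall m n, (M <= m)%N -> (M <= n)%N ->
        Xn (fun z => u m z - u n z) < e) ->
     exists v, X v /\ forall e : R, 0 < e -> exists M : nat, forall n, (M <= n)%N ->
        Xn (fun z => u n z - v z) < e) /\
  (forall f (t : R), X f -> X (fun z => f (z * expi t)) /\ Xn (fun z => f (z * expi t)) = Xn f) /\
  (forall F, entire F -> X F) /\
  (forall f g, X f -> L1_02pi g ->
     let h := fun z => (pi *+ 2)^-1%:C%C * cint02pi (fun t => f (z * expi t) * g t) in
     X h /\
     Xn h <= (pi *+ 2)^-1 *
       Rintegral lebesgue_measure `[0, pi *+ 2]%classic (fun t => cabs (g t)) * Xn f).

Definition best_approx (Xn : (C -> C) -> R) (n : nat) (f : C -> C) : R :=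
  inf [set Xn (fun z => f z - p.[z]) | p in [set p : {poly C} | (size p <= n)%N]].

Definition maxmod (F : C -> C) (r : R) : R :=
  sup [set cabs (F z) | z in [set z | cabs z = r]].

Definition limsup_pinfty (g : R -> R) : \bar R :=
  limf_esup (fun r => (g r)%:E) (pinfty_nbhs R).

Definition order_of (F : C -> C) : \bar R :=
  limsup_pinfty (fun r => ln (ln (maxmod F r)) / ln r).

Definition type_of (F : C -> C) (rho : R) : \bar R :=
  limsup_pinfty (fun r => ln (maxmod F r) / r `^ rho).

End Defs.

(* Main.v *)
Require Import Defs.
From HB Require Import structures.
From mathcomp Require Import all_boot all_order all_algebra.
From mathcomp Require Import all_classical all_reals all_analysis.
From mathcomp Require Import measurable_realfun complex ring lra.
Import Order.TTheory GRing.Theory Num.Theory.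
Import numFieldNormedType.Exports.
Local Open Scope classical_set_scope.
Local Open Scope ring_scope.
Set Implicit Arguments.
Unset Strict Implicit.
Unset Printing Implicit Defensive.

(** Write [f = sum a_n z^n] on the disc.  Convolving [f - p] with [e^(-int)]
    gives [|a_n| ||z^n|| <= E_n(f)], while the Taylor sections give
    [E_n(f) <= sum_(k >= n) |a_k| ||z^k||].  Since [||z^n||^(1/n)] has a positive
    limit (positivity is forced by completeness), for each [s] the bound
    [E_n(f) / ||z^n|| <= (e rho s / n)^(n / rho)] holds eventually iff
    [|a_n| <= (e rho s / n)^(n / rho)] does, up to an arbitrarily small change
    of [s].  The latter is in the same sense equivalent to
    [ln M(r) <= s r^rho] eventually: one direction is Cauchy's estimate at
    [r = (n / (s rho))^(1 / rho)], the other is summation of the maximum term.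
    Hence type and limsup coincide, and a type in (0, oo) determines the order.

    Analyticity is given by local power series only.  That the series at 0
    represents [f] on the whole disc is obtained without Cauchy's
    theorem: on a circle slightly inside the disc [|z| < s] of validity, the
    local expansions have uniform radius and bound by compactness; Cauchy's
    estimate for the local coefficients, followed by Cauchy's estimate for these
    coefficients as functions of the centre, bounds [|a_n| s'^n] for some
    [s' > s]. *)

(** * Modulus, real and imaginary parts, and polar form of complex numbers *)

Section ComplexModulus.
Variable R : realType.
Local Notation C := (R[i]).
Implicit Types (z w : C) (x : R).

Lemma cabs_ge0 z : 0 <= cabs z.
Proof. by case: z => a b; exact: sqrtr_ge0. Qed.

Lemma cabs0 : cabs (0 : C) = 0.
Proof. exact: ComplexField.Normc.normc0. Qed.

Lemma cabs1 : cabs (1 : C) = 1.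
Proof. exact: ComplexField.Normc.normc1. Qed.

Lemma cabs_eq0 z : (cabs z == 0) = (z == 0).
Proof.
apply/eqP/eqP => [|->]; last exact: cabs0.
exact: ComplexField.Normc.eq0_normc.
Qed.

Lemma cabsM z w : cabs (z * w) = cabs z * cabs w.
Proof. exact: ComplexField.Normc.normcM. Qed.

Lemma cabsX z n : cabs (z ^+ n) = cabs z ^+ n.
Proof. by elim: n => [|n IH]; rewrite ?expr0 ?cabs1 // !exprS cabsM IH. Qed.

Lemma cabsN z : cabs (- z) = cabs z.
Proof. exact: normcN. Qed.

Lemma cabs_distC z w : cabs (z - w) = cabs (w - z).
Proof. by rewrite -cabsN opprB. Qed.

Lemma cabsD z w : cabs (z + w) <= cabs z + cabs w.
Proof. exact: le_normcD. Qed.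

Lemma cabs_triangle z w u : cabs (z - u) <= cabs (z - w) + cabs (w - u).
Proof. by rewrite -[z - u](subrKA w); exact: cabsD. Qed.

Lemma cabs_sum (I : Type) (r : seq I) (P : pred I) (F : I -> C) :
  cabs (\sum_(i <- r | P i) F i) <= \sum_(i <- r | P i) cabs (F i).
Proof.
elim/big_rec2: _ => [|i y1 y2 _ h]; first by rewrite cabs0.
by apply: (le_trans (cabsD _ _)); rewrite lerD2l.
Qed.

Lemma cabs_real x : cabs x%:C%C = `|x|.
Proof. by rewrite /cabs /= expr0n /= addr0 sqrtr_sqr. Qed.

Lemma cabs_nat n : cabs (n%:R : C) = n%:R.
Proof.
suff -> : (n%:R : C) = (n%:R : R)%:C%C by rewrite cabs_real ger0_norm.
by rewrite rmorph_nat.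
Qed.

Lemma cabs_expi (t : R) : cabs (expi t) = 1.
Proof. by rewrite /cabs /= cos2Dsin2 sqrtr1. Qed.

Lemma normr_Re_le z : `|complex.Re z| <= cabs z.
Proof.
by case: z => a b /=; rewrite -sqrtr_sqr ler_wsqrtr // lerDl sqr_ge0.
Qed.

Lemma normr_Im_le z : `|complex.Im z| <= cabs z.
Proof.
by case: z => a b /=; rewrite -sqrtr_sqr ler_wsqrtr // lerDr sqr_ge0.
Qed.

Lemma cabs_le_ReIm z : cabs z <= `|complex.Re z| + `|complex.Im z|.
Proof.
case: z => a b /=; rewrite -(ger0_norm (addr_ge0 (normr_ge0 a) (normr_ge0 b))).
rewrite -sqrtr_sqr ler_wsqrtr // sqrrD !real_normK ?num_real //.
by rewrite addrAC lerDl mulrn_wge0 // mulr_ge0.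
Qed.

Lemma ReM z w :
  complex.Re (z * w) = complex.Re z * complex.Re w - complex.Im z * complex.Im w.
Proof. by case: z; case: w. Qed.

Lemma ImM z w :
  complex.Im (z * w) = complex.Re z * complex.Im w + complex.Im z * complex.Re w.
Proof. by case: z => a b; case: w => c d /=. Qed.

Lemma ReD z w : complex.Re (z + w) = complex.Re z + complex.Re w.
Proof. by case: z; case: w. Qed.

Lemma ImD z w : complex.Im (z + w) = complex.Im z + complex.Im w.
Proof. by case: z; case: w. Qed.

Lemma ReN z : complex.Re (- z) = - complex.Re z.
Proof. by case: z. Qed.

Lemma ImN z : complex.Im (- z) = - complex.Im z.
Proof. by case: z. Qed.

Lemma expiD (s t : R) : expi (s + t) = expi s * expi t.
Proof.
apply/eqP; rewrite eq_complex ReM ImM /=.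
by rewrite cosD sinD eqxx /= addrC.
Qed.

Lemma expi0 : expi (0 : R) = 1.
Proof. by rewrite /expi cos0 sin0. Qed.

Lemma expiX (t : R) n : expi t ^+ n = expi (t * n%:R).
Proof.
elim: n => [|n IH]; first by rewrite expr0 mulr0 expi0.
by rewrite exprS IH -expiD mulrSr mulrDr mulr1 addrC.
Qed.

(** The angle is [acos] of Re z / |z|, with its sign taken from Im z. Keeping it in a compact
    segment is what later allows a compactness argument on circles. *)
Lemma polar_form z : exists2 t : R, - pi <= t <= pi & z = (cabs z)%:C%C * expi t.
Proof.
have pi0 := ltW (pi_gt0 R).
have [->|z0] := eqVneq z 0.
  by exists 0; rewrite ?cabs0 ?mul0r // oppr_le0 pi0.
have rp : 0 < cabs z by rewrite lt_def cabs_eq0 z0 cabs_ge0.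
set r := cabs z in rp *.
set a := complex.Re z / r; set b := complex.Im z / r.
have ab : a ^+ 2 + b ^+ 2 = 1.
  have h : r ^+ 2 = complex.Re z ^+ 2 + complex.Im z ^+ 2.
    rewrite /r; case: (z) => x y /=; rewrite sqr_sqrtr //.
    by rewrite addr_ge0 ?sqr_ge0.
  rewrite /a /b !expr_div_n -mulrDl -h divff // expf_neq0 //.
  by rewrite gt_eqF.
have a1 : -1 <= a <= 1.
  rewrite -ler_norml -(@ler_pXn2r _ 2) ?nnegrE // expr1n real_normK ?num_real //.
  by rewrite -ab lerDl sqr_ge0.
have key t : cos t = a -> sin t = b -> z = r%:C%C * expi t.
  move=> ca sb; apply/eqP; rewrite eq_complex ReM ImM /expi ca sb /= !mul0r.
  have r0 : r != 0 by rewrite gt_eqF.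
  by rewrite subr0 addr0 !(mulrC r) !divfK // !eqxx.
have sE : Num.sqrt (1 - a ^+ 2) = `|b|.
  by rewrite -ab addrAC subrr add0r sqrtr_sqr.
have [b0|b0] := leP 0 b.
  exists (acos a); first by rewrite acos_lepi // (le_trans _ (acos_ge0 _)) ?oppr_le0.
  by apply: key; rewrite ?acosK ?sin_acos // sE ger0_norm.
exists (- acos a); first by rewrite lerN2 acos_lepi // lerNl (le_trans _ (acos_ge0 _)) ?oppr_le0.
apply: key; rewrite ?cosN ?sinN ?acosK ?sin_acos // sE.
by rewrite ltr0_norm // opprK.
Qed.

End ComplexModulus.

(** * Convergence of complex sequences; series dominated by geometric ones *)

Section ComplexLimits.
Variable R : realType.
Local Notation C := (R[i]).
Implicit Types (u v : nat -> C) (z w : C) (x q : R).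

Lemma ccvg_uniq u z w : ccvg u z -> ccvg u w -> z = w.
Proof.
move=> uz uw; apply/eqP; rewrite -subr_eq0 -cabs_eq0 eq_le cabs_ge0 andbT.
apply/ler_addgt0Pl => e e0; rewrite addr0.
have [N hN] := uz _ (divr_gt0 e0 (ltr0Sn R 1)).
have [M hM] := uw _ (divr_gt0 e0 (ltr0Sn R 1)).
have h1 := hN _ (leq_maxl N M); have h2 := hM _ (leq_maxr N M).
apply: (le_trans (cabs_triangle _ (u (maxn N M)) _)).
rewrite (splitr e) lerD //; last exact: ltW.
by rewrite cabs_distC ltW.
Qed.

Lemma ccvg_ext u v w : u =1 v -> ccvg u w -> ccvg v w.
Proof. by move=> /funext ->. Qed.

Lemma ccvgD u v z w :
  ccvg u z -> ccvg v w -> ccvg (fun n => u n + v n) (z + w).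
Proof.
move=> uz vw e e0.
have [N hN] := uz _ (divr_gt0 e0 (ltr0Sn R 1)).
have [M hM] := vw _ (divr_gt0 e0 (ltr0Sn R 1)).
exists (maxn N M) => n; rewrite geq_max => /andP[hn hm].
rewrite opprD addrACA.
apply: (le_lt_trans (cabsD _ _)); rewrite (splitr e); apply: ltrD.
  exact: hN.
exact: hM.
Qed.

Lemma ccvg_cst z : ccvg (fun=> z) z.
Proof. by move=> e e0; exists 0%N => n _; rewrite subrr cabs0. Qed.

Lemma ccvgMl u z w : ccvg u w -> ccvg (fun n => z * u n) (z * w).
Proof.
move=> uw e e0.
have c1 : 0 < cabs z + 1 by rewrite ltr_wpDl // cabs_ge0.
have [N hN] := uw _ (divr_gt0 e0 c1).
exists N => n /hN h; rewrite -mulrBr cabsM.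
rewrite ltr_pdivlMr // mulrC in h; apply: le_lt_trans h.
by rewrite ler_wpM2r ?cabs_ge0 // lerDl.
Qed.

Lemma ccvg_sum (K : nat) (U : nat -> nat -> C) (W : nat -> C) :
  (forall k, ccvg (U^~ k) (W k)) ->
  ccvg (fun n => \sum_(k < K) U n k) (\sum_(k < K) W k).
Proof.
move=> h; elim: K => [|K IH].
  rewrite big_ord0; apply: (@ccvg_ext (fun=> 0)); last exact: ccvg_cst.
  by move=> n; rewrite big_ord0.
rewrite big_ord_recr; apply: ccvg_ext (ccvgD _ (h K)); last exact: IH.
by move=> n /=; rewrite big_ord_recr.
Qed.

Lemma ccvg_bound u w z (M : R) (N : nat) :
  ccvg u w -> (forall n, (N <= n)%N -> cabs (u n - z) <= M) -> cabs (w - z) <= M.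
Proof.
move=> uw h; apply/ler_addgt0Pl => e e0.
have [N1 hN] := uw _ e0.
apply: (le_trans (cabs_triangle _ (u (maxn N N1)) _)); apply: lerD.
  by rewrite cabs_distC ltW // hN // leq_maxr.
by apply: h; rewrite leq_maxl.
Qed.

Lemma ccvg_shift u w k : ccvg (fun n => u (n + k)%N) w <-> ccvg u w.
Proof.
split=> h e /h [N hN].
  exists (N + k)%N => n hn; rewrite -(@subnK k n) ?hN //.
    by rewrite leq_subRL ?(leq_trans _ hn) ?leq_addl // addnC.
  by rewrite (leq_trans _ hn) ?leq_addl.
by exists N => n hn; apply: hN; rewrite (leq_trans hn) ?leq_addr.
Qed.

Lemma ccvg_ReIm u w : ccvg u w <->
  (complex.Re (u n) @[n --> \oo] --> complex.Re w) /\
  (complex.Im (u n) @[n --> \oo] --> complex.Im w).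
Proof.
split=> [h|[/cvgrPdist_lt h1 /cvgrPdist_lt h2] e e0].
  split; apply/cvgrPdist_lt => e /h [N hN]; near=> n.
    rewrite -ReN -ReD; apply: (le_lt_trans (normr_Re_le _)).
    by rewrite cabs_distC hN //; near: n; exists N.
  rewrite -ImN -ImD; apply: (le_lt_trans (normr_Im_le _)).
  by rewrite cabs_distC hN //; near: n; exists N.
have e2 := divr_gt0 e0 (ltr0Sn R 1).
have [N _ hN] := h1 _ e2; have [M _ hM] := h2 _ e2.
exists (maxn N M) => n; rewrite geq_max => /andP[/hN /= hn /hM /= hm].
rewrite cabs_distC; apply: (le_lt_trans (cabs_le_ReIm _)).
by rewrite ReD ReN ImD ImN (splitr e) ltrD.
Unshelve. all: by end_near. Qed.

Lemma geometric_small (B q e : R) : 0 <= q < 1 -> 0 < e ->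
  exists N : nat, forall n, (N <= n)%N -> B * q ^+ n / (1 - q) < e.
Proof.
move=> /andP[q0 q1] e0.
have : (fun n => B * q ^+ n / (1 - q)) @ \oo --> (B * 0 / (1 - q) : R).
  apply: cvgMl; apply: cvgMr; apply: cvg_expr.
  by rewrite ger0_norm.
rewrite mulr0 mul0r => /cvgrPdist_lt /(_ _ e0) [N _ hN].
exists N => n /hN /=; rewrite sub0r normrN; apply: le_lt_trans.
exact: ler_norm.
Qed.

Lemma geometric_tail_le (q : R) (m n : nat) : 0 <= q < 1 ->
  \sum_(m <= k < n) q ^+ k <= q ^+ m / (1 - q).
Proof.
move=> /andP[q0 q1]; have q1' : 0 < 1 - q by rewrite subr_gt0.
have [mn|nm] := leqP m n; last first.
  by rewrite big_geq ?(ltnW nm) // divr_ge0 ?exprn_ge0 // ltW.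
rewrite ler_pdivlMr //; elim: n mn => [|n IH].
  by rewrite leqn0 => /eqP ->; rewrite big_geq // mul0r exprn_ge0.
rewrite leq_eqVlt => /orP[/eqP <-|].
  by rewrite big_geq // mul0r exprn_ge0.
rewrite ltnS => mn.
suff E : (\sum_(m <= k < n.+1) q ^+ k) * (1 - q) = q ^+ m - q ^+ n.+1.
  by rewrite E gerBl exprn_ge0.
elim: n mn {IH} => [|n IH].
  by rewrite leqn0 => /eqP ->; rewrite big_nat1 expr0 expr1 mul1r.
rewrite leq_eqVlt => /orP[/eqP <-|mn].
  by rewrite big_nat1 mulrBr mulr1 -exprSr.
rewrite big_nat_recr /= ?(ltnW mn) // mulrDl IH // !exprS; ring.
Qed.

Lemma complex_cauchy u :
  (forall e : R, 0 < e -> exists N, forall m n, (N <= m)%N -> (N <= n)%N ->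
     cabs (u m - u n) < e) ->
  exists w, ccvg u w.
Proof.
move=> h.
(* Real and imaginary parts are 1-Lipschitz, so both inherit the Cauchy property. *)
have cR (f : C -> R) : (forall z w, `|f z - f w| <= cabs (z - w)) ->
    cvgn (fun n => f (u n)).
  move=> fle; apply/cauchy_cvgP/cauchy_exP => e e0; rewrite /cauchy_ex.
  have [N hN] := h _ e0; exists (f (u N)); exists N => // n /= Nn.
  by rewrite /ball /= (le_lt_trans (fle _ _)) // hN.
have h1 : cvgn (fun n => complex.Re (u n)).
  by apply: cR => z w; rewrite -ReN -ReD normr_Re_le.
have h2 : cvgn (fun n => complex.Im (u n)).
  by apply: cR => z w; rewrite -ImN -ImD normr_Im_le.
exists (limn (fun n => complex.Re (u n)) +i* limn (fun n => complex.Im (u n)))%C.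
by apply/ccvg_ReIm; split.
Qed.

Lemma sum_ord_nat_diff (c : nat -> C) (m n : nat) : (m <= n)%N ->
  \sum_(k < n) c k - \sum_(k < m) c k = \sum_(m <= k < n) c k.
Proof.
move=> mn; rewrite -!(big_mkord xpredT c) (big_cat_nat (leq0n m) mn) /=.
by rewrite addrAC subrr add0r.
Qed.

Lemma geometric_tail_bound (c : nat -> C) (B q : R) (m n : nat) :
  0 <= q < 1 -> 0 <= B -> (forall k, (m <= k)%N -> cabs (c k) <= B * q ^+ k) ->
  (m <= n)%N -> cabs (\sum_(k < n) c k - \sum_(k < m) c k) <= B * q ^+ m / (1 - q).
Proof.
move=> hq B0 h mn; rewrite sum_ord_nat_diff //.
apply: (le_trans (cabs_sum _ _ _)).
rewrite -mulrA; apply: le_trans (ler_wpM2l B0 (geometric_tail_le m n hq)).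
by rewrite mulr_sumr big_nat [leRHS]big_nat; apply: ler_sum => k /andP[/h].
Qed.

Lemma geometric_dominated_cvg (c : nat -> C) (B q : R) :
  0 <= q < 1 -> (forall k, cabs (c k) <= B * q ^+ k) ->
  exists w, ccvg (fun n => \sum_(k < n) c k) w.
Proof.
move=> hq h.
have B0 : 0 <= B by have := h 0%N; rewrite expr0 mulr1; apply: le_trans; exact: cabs_ge0.
apply: complex_cauchy => e e0.
have [N hN] := geometric_small B hq e0; exists N => m n.
wlog mn : m n / (m <= n)%N.
  move=> H; have [mn|/ltnW nm] := leqP m n; first exact: H.
  by move=> h1 h2; rewrite cabs_distC; apply: H.
move=> Nm Nn; rewrite cabs_distC; apply: le_lt_trans (hN _ Nm).
exact: geometric_tail_bound.
Qed.

End ComplexLimits.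

(** * Power series on a disc and their re-expansion about another centre *)

Section PowerSeries.
Variable R : realType.
Local Notation C := (R[i]).
Implicit Types (c d : nat -> C) (r rho B : R) (h : C -> C) (z w : C).

(** An expansion about another centre [z] is expressed as [psum] of the translate
    [fun w => f (z + w)]. *)
Definition psum c r h := forall w, cabs w < r ->
  ccvg (fun n => \sum_(k < n) c k * w ^+ k) (h w).

Lemma psumW c r s h : s <= r -> psum c r h -> psum c s h.
Proof. by move=> sr H w ws; apply: H; apply: lt_le_trans sr. Qed.

(** Each term of the series at the point [rho] is a difference of two consecutive partial sums. Once
    both lie within 1 of the limit it is at most 2, and the finitely many earlier terms are simply
    added up. *)
Lemma psum_coef_bounded c r h rho : psum c r h -> 0 <= rho < r ->
  exists2 B, 0 <= B & forall k, cabs (c k) * rho ^+ k <= B.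
Proof.
move=> H /andP[rho0 rhor].
have [] := H rho%:C%C _ 1 ltr01; first by rewrite cabs_real ger0_norm.
move=> N hN; exists (\sum_(k < N) cabs (c k) * rho ^+ k + 2) => [|k].
  rewrite addr_ge0 // sumr_ge0 // => k _.
  by rewrite mulr_ge0 ?cabs_ge0 ?exprn_ge0.
have p k' : 0 <= cabs (c k') * rho ^+ k' by rewrite mulr_ge0 ?cabs_ge0 ?exprn_ge0.
have [kN|Nk] := ltnP k N.
  rewrite (bigD1 (Ordinal kN)) //= -addrA lerDl addr_ge0 // sumr_ge0 //.
apply: (@le_trans _ _ 2); last by rewrite lerDr sumr_ge0.
have E : cabs (c k) * rho ^+ k = cabs (c k * rho%:C%C ^+ k).
  by rewrite cabsM cabsX cabs_real (ger0_norm rho0).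
have E2 : c k * rho%:C%C ^+ k =
  \sum_(i < k.+1) c i * rho%:C%C ^+ i - \sum_(i < k) c i * rho%:C%C ^+ i.
  by rewrite big_ord_recr /= addrAC subrr add0r.
rewrite {}E {}E2; apply: (le_trans (cabs_triangle _ (h rho%:C%C) _)).
rewrite -[2]/(1 + 1); apply: lerD; first by rewrite ltW // hN // leqW.
by rewrite cabs_distC ltW // hN.
Qed.

Lemma coef_bound_geometric c B rho w k : 0 < rho -> cabs (c k) * rho ^+ k <= B ->
  cabs (c k * w ^+ k) <= B * (cabs w / rho) ^+ k.
Proof.
move=> rho0 h; rewrite cabsM cabsX expr_div_n mulrC.
have -> : B * (cabs w ^+ k / rho ^+ k) = cabs w ^+ k * (B / rho ^+ k) by ring.
by rewrite ler_wpM2l ?exprn_ge0 ?cabs_ge0 // ler_pdivlMr ?exprn_gt0.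
Qed.

Lemma ratio_lt1 w rho : cabs w < rho -> 0 <= cabs w / rho < 1.
Proof.
move=> wr; have rho0 : 0 < rho by apply: le_lt_trans wr; exact: cabs_ge0.
by rewrite divr_ge0 ?cabs_ge0 ?(ltW rho0) //= ltr_pdivrMr // mul1r.
Qed.

Lemma bounded_coef_cvg c B rho w : (forall k, cabs (c k) * rho ^+ k <= B) ->
  cabs w < rho -> exists l, ccvg (fun n => \sum_(k < n) c k * w ^+ k) l.
Proof.
move=> hB wr; have rho0 : 0 < rho by apply: le_lt_trans wr; exact: cabs_ge0.
apply: (@geometric_dominated_cvg _ (fun k => c k * w ^+ k) B (cabs w / rho)); first exact: ratio_lt1.
by move=> k; exact: coef_bound_geometric.
Qed.

Lemma psum_exists c r :
  (forall rho, 0 < rho < r -> exists B, forall k, cabs (c k) * rho ^+ k <= B) ->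
  exists h, psum c r h.
Proof.
move=> H; suff /choice[h hh] : forall w, exists l, cabs w < r ->
    ccvg (fun n => \sum_(k < n) c k * w ^+ k) l by exists h.
move=> w; have [wr|_] := boolP (cabs w < r); last by exists 0.
have [|B hB] := H ((cabs w + r) / 2).
  by have := cabs_ge0 w => w0; apply/andP; split; lra.
have [|l hl] := bounded_coef_cvg (w := w) hB; last by exists l.
by lra.
Qed.

(** The coefficients of the [k]-th derivative divided by k!. *)
Definition shifted_coef k c : nat -> C := fun n => 'C(n + k, k)%:R * c (n + k)%N.

Lemma binomial_term_le (x t : R) n k : 0 <= x -> 0 <= t ->
  'C(n + k, k)%:R * x ^+ n * t ^+ k <= (x + t) ^+ (n + k).
Proof.
move=> x0 t0; rewrite exprDn.
have hk : (k < (n + k).+1)%N by rewrite ltnS leq_addl.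
rewrite (bigD1 (Ordinal hk)) //= addnK -[X in _ <= X + _]mulr_natl mulrA lerDl sumr_ge0 // => i _.
by rewrite mulrn_wge0 // mulr_ge0 // exprn_ge0.
Qed.

(** A single term of the binomial expansion of (x + t)^(n + k) is at most the whole power. *)
Lemma shifted_coef_bound c B x t k : 0 <= x -> 0 < t ->
  (forall n, cabs (c n) * (x + t) ^+ n <= B) ->
  forall n, cabs (shifted_coef k c n) * x ^+ n <= B / t ^+ k.
Proof.
move=> x0 t0 hB n; rewrite ler_pdivlMr ?exprn_gt0 //.
apply: le_trans (hB (n + k)%N); rewrite /shifted_coef cabsM cabs_nat.
have -> : 'C(n + k, k)%:R * cabs (c (n + k)%N) * x ^+ n * t ^+ k =
  cabs (c (n + k)%N) * ('C(n + k, k)%:R * x ^+ n * t ^+ k) by ring.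
by rewrite ler_wpM2l ?cabs_ge0 // binomial_term_le // ltW.
Qed.

(** A range [K] independent of [m] lets the order of a double sum be exchanged. Indices k > m are
    harmless: the binomial coefficient vanishes there, whatever the truncated [m - k] is. *)
Lemma binomial_truncated (A : comPzRingType) (z w : A) m K : (m < K)%N ->
  \sum_(k < K) z ^+ (m - k) * w ^+ k *+ 'C(m, k) = (z + w) ^+ m.
Proof.
move=> mK; rewrite exprDn (big_ord_widen K (fun k => z ^+ (m - k) * w ^+ k *+ 'C(m, k)) mK).
rewrite [RHS]big_mkcond /=; apply: eq_bigr => k _.
by case: ltnP => // /bin_small ->; rewrite mulr0n.
Qed.

Lemma shifted_partial_sum c z k N :
  \sum_(m < N) c m * (z ^+ (m - k) *+ 'C(m, k)) =
  \sum_(n < N - k) shifted_coef k c n * z ^+ n.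
Proof.
elim: N => [|N IH]; first by rewrite sub0n !big_ord0.
rewrite big_ord_recr /= IH; have [kN|Nk] := leqP k N; last first.
  have -> : (N - k = 0)%N by apply/eqP; rewrite subn_eq0 ltnW.
  have -> : (N.+1 - k = 0)%N by apply/eqP; rewrite subn_eq0.
  by rewrite bin_small // mulr0n mulr0 addr0.
rewrite subSn // big_ord_recr /=; congr (_ + _).
by rewrite /shifted_coef subnK // -mulr_natl mulrA [_ * c N]mulrC.
Qed.

(** Rearrangement of the double series sum_m c_m sum_k C(m,k) z^(m-k) w^k. The new coefficients are
    delivered as functions of the centre with power series of their own, so that Cauchy's estimate
    can be applied to them too. *)
Lemma psum_reexpand c r h : psum c r h -> exists b : nat -> C -> C,
  (forall k, psum (shifted_coef k c) r (b k)) /\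
  forall z w, cabs z + cabs w < r ->
    ccvg (fun n => \sum_(k < n) b k z * w ^+ k) (h (z + w)).
Proof.
move=> H.
have /choice[b hb] : forall k, exists bk, psum (shifted_coef k c) r bk.
  move=> k.
  apply: psum_exists => rho /andP[rho0 rhor].
  have [|B B0 hB] := psum_coef_bounded (rho := (rho + r) / 2) H.
    by apply/andP; split; lra.
  exists (B / ((r - rho) / 2) ^+ k); apply: shifted_coef_bound; first exact: ltW.
    by lra.
  by move=> n; have -> : rho + (r - rho) / 2 = (rho + r) / 2 by field.
exists b; split => // z w zwr.
have [z0 w0] := (cabs_ge0 z, cabs_ge0 w).
pose rho := (cabs z + cabs w + r) / 2.
have [|B B0 hB] := psum_coef_bounded (rho := rho) H.
  by rewrite /rho; apply/andP; split; lra.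
have rho0 : 0 < rho by rewrite /rho; lra.
pose q := (cabs z + cabs w) / rho.
have hq : 0 <= q < 1.
  by rewrite /q divr_ge0 ?addr_ge0 ?(ltW rho0) //= ltr_pdivrMr // mul1r /rho; lra.
(* Cutting the inner sum at any [K] leaves it below (|z| + |w|)^m, hence a geometric bound uniform
   in [K]. *)
have term m K : cabs (\sum_(k < K) c m * (z ^+ (m - k) * w ^+ k *+ 'C(m, k)))
    <= B * q ^+ m.
  rewrite -mulr_sumr cabsM.
  apply: (@le_trans _ _ (cabs (c m) * (cabs z + cabs w) ^+ m)).
    rewrite ler_wpM2l ?cabs_ge0 // -(binomial_truncated _ _ (leq_maxl m.+1 K)).
    apply: (le_trans (cabs_sum _ _ _)).
    rewrite (big_ord_widen _ (fun k => cabs (z ^+ (m - k) * w ^+ k *+ 'C(m, k)))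
      (leq_maxr m.+1 K)) big_mkcond /=.
    apply: ler_sum => k _; have p : 0 <= cabs z ^+ (m - k) * cabs w ^+ k *+ 'C(m, k).
      by rewrite mulrn_wge0 // mulr_ge0 // exprn_ge0.
    case: ifP => // _.
    by rewrite -mulr_natl cabsM cabs_nat cabsM !cabsX mulr_natl.
  have := hB m; rewrite /q (expr_div_n (cabs z + cabs w)) => hm.
  have -> : B * ((cabs z + cabs w) ^+ m / rho ^+ m) =
    (B / rho ^+ m) * (cabs z + cabs w) ^+ m by ring.
  by rewrite ler_wpM2r ?exprn_ge0 ?addr_ge0 // ler_pdivlMr ?exprn_gt0.
(* Cutting at k < K has no effect on the terms with m < K, so the two partial sums differ only by
   terms with m >= K. *)
have close K : cabs (\sum_(k < K) b k z * w ^+ k - \sum_(m < K) c m * (z + w) ^+ m)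
    <= B * q ^+ K / (1 - q).
  (* [Q N] cuts m at [N] and k at [K]: it tends to the first [K] terms of the new series as N grows,
     while [Q K] is a partial sum of the old one. *)
  pose Q N := \sum_(m < N) \sum_(k < K) c m * (z ^+ (m - k) * w ^+ k *+ 'C(m, k)).
  have QE N : Q N = \sum_(k < K) w ^+ k * \sum_(n < N - k) shifted_coef k c n * z ^+ n.
    rewrite /Q exchange_big /=; apply: eq_bigr => k _.
    rewrite -shifted_partial_sum mulr_sumr; apply: eq_bigr => m _.
    by rewrite -mulrnAl mulrA mulrC.
  have Qcvg : ccvg Q (\sum_(k < K) b k z * w ^+ k).
    apply: ccvg_ext (fsym QE) _.
    have -> : \sum_(k < K) b k z * w ^+ k = \sum_(k < K) w ^+ k * b k z.
      by apply: eq_bigr => k _; rewrite mulrC.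
    apply: (@ccvg_sum _ K (fun N k => w ^+ k * \sum_(n < N - k) shifted_coef k c n * z ^+ n)
      (fun k => w ^+ k * b k z)) => k.
    apply: ccvgMl; apply/(ccvg_shift _ _ k).
    apply: (ccvg_ext (u := fun n => \sum_(i < n) shifted_coef k c i * z ^+ i)).
      by move=> n /=; rewrite addnK.
    by apply: hb; apply: le_lt_trans zwr; rewrite lerDl.
  apply: (ccvg_bound (N := K) Qcvg) => N KN.
  have -> : \sum_(m < K) c m * (z + w) ^+ m = Q K.
    by apply: eq_bigr => m _; rewrite -mulr_sumr binomial_truncated.
  apply: (@geometric_tail_bound _ (fun m =>
    \sum_(k < K) c m * (z ^+ (m - k) * w ^+ k *+ 'C(m, k))) B q K N) => // m _.
move=> e e0; have e2 := divr_gt0 e0 (ltr0Sn R 1).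
have [N1 h1] := geometric_small B hq e2.
have [|N2 h2] := H (z + w) _ _ e2; first exact: le_lt_trans (cabsD _ _) zwr.
exists (maxn N1 N2) => n; rewrite geq_max => /andP[/h1 hn1 /h2 hn2].
apply: (le_lt_trans (cabs_triangle _ (\sum_(m < n) c m * (z + w) ^+ m) _)).
by rewrite (splitr e) ltrD // (le_lt_trans (close n)).
Qed.

End PowerSeries.

(** * Integration of complex functions over [0, 2 pi] and orthogonality of exponentials *)

Section CircleIntegral.
Variable R : realType.
Local Notation C := (R[i]).
Local Notation D := (`[0, (pi *+ 2 : R)]%classic).
Local Notation leb := (@lebesgue_measure R).
Implicit Types (h g : R -> C) (M : R).

Lemma pi2_gt0 : 0 < (pi : R) *+ 2.
Proof. by rewrite mulrn_wgt0 // pi_gt0. Qed.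

Lemma measure_02pi : leb D = (pi *+ 2)%:E.
Proof. by rewrite lebesgue_measure_itv /= lte_fin pi2_gt0 oppr0 adde0. Qed.

Lemma integrable_cst_02pi M : leb.-integrable D (EFin \o (fun=> M)).
Proof.
apply: continuous_compact_integrable; first exact: segment_compact.
by move=> x; exact: cst_continuous.
Qed.

Lemma integrable_bounded_cvg (u : nat -> R -> R) (f : R -> R) M :
  (forall n, leb.-integrable D (EFin \o u n)) ->
  (forall t, u ^~ t @ \oo --> f t) -> (forall n t, `|u n t| <= M) ->
  leb.-integrable D (EFin \o f) /\
  (Rintegral leb D (u n) @[n --> \oo] --> Rintegral leb D f).
Proof.
move=> iu uf uM.
have mD : measurable D by [].
have mu n : measurable_fun D (u n) by apply/measurable_EFinP; case/integrableP : (iu n).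
have mf : measurable_fun D f by apply: (measurable_fun_cvg mu) => t _; exact: uf.
have [] := @dominated_convergence _ _ R leb D mD (fun n => EFin \o u n) (EFin \o f)
  (EFin \o (fun=> M)).
- by move=> n; apply/measurable_EFinP; exact: mu.
- by apply/measurable_EFinP.
- by apply: aeW => t _; apply: cvg_EFin; [exact: nearW|exact: uf].
- exact: integrable_cst_02pi.
- by apply: aeW => t n _ /=; rewrite lee_fin.
move=> ifD _ cv; split => //; rewrite /Rintegral.
apply: fine_cvg; rewrite fineK //; exact: integrable_fin_num.
Qed.

Lemma L1_02piD h g : L1_02pi h -> L1_02pi g -> L1_02pi (fun t => h t + g t).
Proof.
move=> [h1 h2] [g1 g2]; split.
  rewrite [X in integrable _ _ X](_ : _ = (fun t => (complex.Re (h t))%:E) \+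
     (fun t => (complex.Re (g t))%:E))%E; first exact: integrableD.
  by apply/funext => t /=; rewrite ReD EFinD.
rewrite [X in integrable _ _ X](_ : _ = (fun t => (complex.Im (h t))%:E) \+
     (fun t => (complex.Im (g t))%:E))%E; first exact: integrableD.
by apply/funext => t /=; rewrite ImD EFinD.
Qed.

Lemma cint02piD h g : L1_02pi h -> L1_02pi g ->
  cint02pi (fun t => h t + g t) = cint02pi h + cint02pi g.
Proof.
move=> [h1 h2] [g1 g2]; apply/eqP; rewrite eq_complex ReD ImD /=.
apply/andP; split; apply/eqP; rewrite -RintegralD //; apply: eq_Rintegral => t _.
  exact: ReD.
exact: ImD.
Qed.

Lemma L1_02piZ (z : C) h : L1_02pi h -> L1_02pi (fun t => z * h t).
Proof.
move=> [h1 h2]; split.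
  rewrite [X in integrable _ _ X](_ : _ = (fun t => (complex.Re z)%:E * (complex.Re (h t))%:E) \+
     (fun t => (- complex.Im z)%:E * (complex.Im (h t))%:E))%E; last first.
    by apply/funext => t /=; rewrite ReM -!EFinM -EFinD mulNr.
  by apply: integrableD => //; exact: integrableZl.
rewrite [X in integrable _ _ X](_ : _ = (fun t => (complex.Re z)%:E * (complex.Im (h t))%:E) \+
     (fun t => (complex.Im z)%:E * (complex.Re (h t))%:E))%E; last first.
  by apply/funext => t /=; rewrite ImM -!EFinM -EFinD.
by apply: integrableD => //; exact: integrableZl.
Qed.

Lemma cint02piZ (z : C) h : L1_02pi h -> cint02pi (fun t => z * h t) = z * cint02pi h.
Proof.
move=> [h1 h2].
have i1 a : leb.-integrable D (EFin \o (fun t => a * complex.Re (h t))).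
  rewrite [X in integrable _ _ X](_ : _ = (fun t => a%:E * (complex.Re (h t))%:E)%E) //.
  exact: integrableZl.
have i2 a : leb.-integrable D (EFin \o (fun t => a * complex.Im (h t))).
  rewrite [X in integrable _ _ X](_ : _ = (fun t => a%:E * (complex.Im (h t))%:E)%E) //.
  exact: integrableZl.
apply/eqP; rewrite eq_complex ReM ImM /=; apply/andP; split; apply/eqP.
  rewrite -!RintegralZl // -RintegralB //; apply: eq_Rintegral => t _.
  exact: ReM.
rewrite -!RintegralZl // -RintegralD //; apply: eq_Rintegral => t _.
exact: ImM.
Qed.

Lemma cint02pi_cvg (u : nat -> R -> C) h M : (forall n, L1_02pi (u n)) ->
  (forall t, ccvg (u ^~ t) (h t)) -> (forall n t, cabs (u n t) <= M) ->
  L1_02pi h /\ ccvg (fun n => cint02pi (u n)) (cint02pi h).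
Proof.
move=> iu uh uM.
have [|||i1 c1] := @integrable_bounded_cvg (fun n t => complex.Re (u n t))
  (fun t => complex.Re (h t)) M.
- by move=> n; have [] := iu n.
- by move=> t; have [] := (ccvg_ReIm _ _).1 (uh t).
- by move=> n t; apply: le_trans (uM n t); exact: normr_Re_le.
have [|||i2 c2] := @integrable_bounded_cvg (fun n t => complex.Im (u n t))
  (fun t => complex.Im (h t)) M.
- by move=> n; have [] := iu n.
- by move=> t; have [] := (ccvg_ReIm _ _).1 (uh t).
- by move=> n t; apply: le_trans (uM n t); exact: normr_Im_le.
by split => //; apply/ccvg_ReIm.
Qed.

(** The factor 2 comes from estimating real and imaginary parts separately. It persists in
    [cauchy_estimate], where a constant factor does no harm to growth rates. *)
Lemma cabs_cint02pi_le h M : L1_02pi h -> (forall t, cabs (h t) <= M) ->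
  cabs (cint02pi h) <= 2 * (M * (pi *+ 2)).
Proof.
move=> [h1 h2] hM.
have key (f : R -> R) : leb.-integrable D (EFin \o f) ->
    (forall t, `|f t| <= M) -> `|Rintegral leb D f| <= M * (pi *+ 2).
  move=> i1 fM; apply: (le_trans (le_normr_Rintegral _ i1)) => //.
  have -> : M * (pi *+ 2) = Rintegral leb D (fun=> M).
    by rewrite Rintegral_cst // [X in fine X]measure_02pi.
  apply: le_Rintegral => //; first exact: (integrable_norm i1).
  exact: integrable_cst_02pi.
apply: (le_trans (cabs_le_ReIm _)); rewrite mulr_natl mulr2n; apply: lerD => /=.
  by apply: key => // t; apply: le_trans (hM t); exact: normr_Re_le.
by apply: key => // t; apply: le_trans (hM t); exact: normr_Im_le.
Qed.

Lemma cos_sin_2pi_nat n : cos (pi *+ 2 * n%:R : R) = 1 /\ sin (pi *+ 2 * n%:R : R) = 0.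
Proof.
have : expi (pi *+ 2 * n%:R : R) = 1.
  rewrite -expiX; have -> : expi (pi *+ 2 : R) = 1.
    by rewrite /expi cos2pi sin2pi.
  by rewrite expr1n.
by move=> [-> ->].
Qed.

Lemma continuous_trig (a : R) :
  continuous (fun t : R => cos (a * t)) /\ continuous (fun t : R => sin (a * t)).
Proof.
have c : continuous (fun t : R => a * t) by move=> t; exact: mulrl_continuous.
split => t; apply: continuous_comp; [exact: c|exact: continuous_cos|exact: c|exact: continuous_sin].
Qed.

Lemma integrable_trig (a : R) :
  leb.-integrable D (EFin \o (fun t => cos (a * t))) /\
  leb.-integrable D (EFin \o (fun t => sin (a * t))).
Proof.
have [c s] := continuous_trig a.
by split; (apply: continuous_compact_integrable; first exact: segment_compact);
  apply: continuous_subspaceT.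
Qed.

Lemma integral_trig n : (0 < n)%N ->
  Rintegral leb D (fun t => cos (n%:R * t)) = 0 /\
  Rintegral leb D (fun t => sin (n%:R * t)) = 0.
Proof.
move=> n0; have nn0 : (n%:R : R) != 0 by rewrite pnatr_eq0 -lt0n.
have [c s] := continuous_trig n%:R.
have FTC (f F : R -> R) : continuous f -> (forall t : R, is_derive t (1:R) F (f t)) ->
    Rintegral leb D f = F (pi *+ 2) - F 0.
  move=> cf dF; rewrite /Rintegral (@continuous_FTC2 _ f F) //.
  - exact: pi2_gt0.
  - exact: continuous_subspaceT.
  - have cF : continuous F.
      by move=> t; apply/differentiable_continuous/derivable1_diffP; have [] := dF t.
    split; [by move=> t _; have [] := dF t|exact/cvg_at_right_filter/cF|].
    exact/cvg_at_left_filter/cF.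
  - by move=> t _; rewrite derive1E; exact: derive_val.
have [h1 h2] := cos_sin_2pi_nat n.
split.
  have d (t : R) : is_derive t (1 : R) (fun t => sin (n%:R * t) / n%:R) (cos (n%:R * t)).
    apply: is_derive_eq => //.
    (* This is the product rule with the constant factor 1/n, whose own derivative is 0. *)
    rewrite -[LHS]/(sin (n%:R * t) * (- n%:R ^- 2 * 0) + n%:R^-1 * (cos (n%:R * t) * (n%:R * 1))).
    by rewrite !mulr0 add0r mulr1 mulrC mulfK.
  by rewrite (FTC _ _ c d) mulr0 sin0 [_%:R * _]mulrC h2 mul0r subrr.
have d (t : R) : is_derive t (1 : R) (fun t => - cos (n%:R * t) / n%:R) (sin (n%:R * t)).
  apply: is_derive_eq => //.
  rewrite -[LHS]/(- cos (n%:R * t) * (- n%:R ^- 2 * 0) +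
    n%:R^-1 * - (- sin (n%:R * t) * (n%:R * 1))).
  by rewrite !mulr0 add0r mulr1 mulNr opprK mulrC mulfK.
by rewrite (FTC _ _ s d) mulr0 cos0 [_%:R * _]mulrC h1 subrr.
Qed.

Lemma L1_expi (a : R) : L1_02pi (fun t : R => expi (a * t)).
Proof. by have [] := integrable_trig a; split. Qed.

Lemma cint02pi_expi_nat n : (0 < n)%N ->
  cint02pi (fun t : R => expi (n%:R * t)) = 0 /\
  cint02pi (fun t : R => expi (- n%:R * t)) = 0.
Proof.
move=> n0; have [h1 h2] := integral_trig n0.
split; apply/eqP; rewrite eq_complex /= ?h1 ?h2 ?eqxx //.
have -> : (fun t : R => cos (- n%:R * t)) = (fun t => cos (n%:R * t)).
  by apply/funext => t; rewrite mulNr cosN.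
have -> : Rintegral leb D (fun t : R => sin (- n%:R * t)) =
    Rintegral leb D (fun t => -1 * sin (n%:R * t)).
  by apply: eq_Rintegral => t _; rewrite mulNr sinN mulN1r.
rewrite RintegralZl // ?h1 ?h2 ?mulr0 ?eqxx //.
by have [] := integrable_trig n%:R.
Qed.

Lemma cint02pi_expi (k n : nat) :
  cint02pi (fun t : R => expi ((k%:R - n%:R) * t)) = (if k == n then (pi *+ 2)%:C%C else 0).
Proof.
case: eqVneq => [->|kn].
  rewrite subrr; apply/eqP; rewrite eq_complex /=.
  have -> : (fun t : R => cos (0 * t)) = (fun=> 1) by apply/funext => t; rewrite mul0r cos0.
  have -> : (fun t : R => sin (0 * t)) = (fun=> 0) by apply/funext => t; rewrite mul0r sin0.
  by rewrite !Rintegral_cst // mul1r mul0r [X in fine X]measure_02pi !eqxx.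
have [kn'|nk] := leqP k n.
  have -> : (k%:R - n%:R : R) = - (n - k)%N%:R by rewrite natrB // opprB.
  have [//|_ ->//] := @cint02pi_expi_nat (n - k).
  by rewrite subn_gt0 ltn_neqAle kn.
have -> : (k%:R - n%:R : R) = (k - n)%N%:R by rewrite natrB // ltnW.
by have [|->] := @cint02pi_expi_nat (k - n); rewrite // subn_gt0.
Qed.

End CircleIntegral.

(** * Fourier integrals of power series: uniqueness of coefficients and Cauchy's estimate *)

Section CauchyCoefficients.
Variable R : realType.
Local Notation C := (R[i]).
Implicit Types (c d : nat -> C) (r rho M : R) (f h : C -> C) (z w : C).

(** A geometric series of ratio |z| / rho, with rho strictly between |z| and r, dominates all
    partial sums on the closed disc. The resulting constant serves as dominating function under the
    integral. *)
Lemma psum_partial_bound c r h z : psum c r h -> cabs z < r ->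
  exists M, forall w n, cabs w <= cabs z -> cabs (\sum_(k < n) c k * w ^+ k) <= M.
Proof.
move=> H zr; have z0 := cabs_ge0 z; pose rho := (cabs z + r) / 2.
have [|B B0 hB] := psum_coef_bounded (rho := rho) H.
  by rewrite /rho; apply/andP; split; lra.
have rho0 : 0 < rho by rewrite /rho; lra.
have hq : 0 <= cabs z / rho < 1 by apply: ratio_lt1; rewrite /rho; lra.
exists (B * (cabs z / rho) ^+ 0 / (1 - cabs z / rho)) => w n wz.
have := @geometric_tail_bound _ (fun k => c k * w ^+ k) B (cabs z / rho) 0 n hq B0 _ (leq0n n).
rewrite big_ord0 subr0; apply => k _.
apply: le_trans (coef_bound_geometric w rho0 (hB k)) _.
apply: ler_wpM2l => //; apply: lerXn2r; rewrite ?nnegrE.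
- by apply: divr_ge0; [exact: cabs_ge0|exact: ltW].
- by case/andP: hq.
by rewrite ler_wpM2r // invr_ge0 ltW.
Qed.

Lemma psum_bounded c r h rho : psum c r h -> 0 <= rho < r ->
  exists M, forall w, cabs w <= rho -> cabs (h w) <= M.
Proof.
move=> H /andP[rho0 rhor].
have rE : cabs (rho%:C%C : C) = rho by rewrite cabs_real ger0_norm.
have [|M hM] := psum_partial_bound (z := rho%:C%C) H; first by rewrite rE.
exists M => w wr; rewrite -[h w]subr0.
apply: (ccvg_bound (N := 0) (H w _)); first exact: le_lt_trans rhor.
by move=> n _; rewrite subr0 hM // rE.
Qed.

(** Orthogonality evaluates the integral of each partial sum, and dominated convergence passes to
    the limit. *)
Lemma expi_coef_integral c r h z n : psum c r h -> cabs z < r ->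
  L1_02pi (fun t => h (z * expi t) * expi (- n%:R * t)) /\
  cint02pi (fun t => h (z * expi t) * expi (- n%:R * t)) =
    (pi *+ 2)%:C%C * (c n * z ^+ n).
Proof.
move=> H zr.
pose u N t := (\sum_(k < N) c k * (z * expi t) ^+ k) * expi (- n%:R * t) : C.
have uS N : u N.+1 = (fun t => u N t + (c N * z ^+ N) * expi ((N%:R - n%:R) * t)).
  apply/funext => t; rewrite /u big_ord_recr /= mulrDl; congr (_ + _).
  rewrite mulrDl expiD exprMn expiX -!mulrA; congr (_ * (_ * (_ * _))).
  by rewrite mulrC.
(* Writing the empty sum as a multiple of an exponential lets its integrability and its integral
   follow from the scaling lemmas. *)
have u0 : u 0%N = (fun t => 0 * expi (n%:R * t)).
  by apply/funext => t; rewrite /u big_ord0 !mul0r.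
have uI N : L1_02pi (u N).
  elim: N => [|N IH]; first by rewrite u0; apply: L1_02piZ; exact: L1_expi.
  by rewrite uS; apply: L1_02piD => //; apply: L1_02piZ; exact: L1_expi.
have uE N : cint02pi (u N) =
    \sum_(k < N) c k * z ^+ k * (if (k : nat) == n then (pi *+ 2)%:C%C else 0).
  elim: N => [|N IH].
    by rewrite u0 cint02piZ ?mul0r ?big_ord0 //; exact: L1_expi.
  rewrite uS cint02piD //; last by apply: L1_02piZ; exact: L1_expi.
  by rewrite cint02piZ ?cint02pi_expi ?IH ?big_ord_recr //; exact: L1_expi.
have [M hM] := psum_partial_bound H zr.
have [|||hI hc] := @cint02pi_cvg _ u (fun t => h (z * expi t) * expi (- n%:R * t)) M.
- exact: uI.
- move=> t; rewrite mulrC; apply: (ccvg_ext (u := fun N =>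
    expi (- n%:R * t) * \sum_(k < N) c k * (z * expi t) ^+ k)).
    by move=> N; rewrite mulrC.
  by apply: ccvgMl; apply: H; rewrite cabsM cabs_expi mulr1.
- by move=> N t; rewrite /u cabsM cabs_expi mulr1 hM // cabsM cabs_expi mulr1.
(* From N = n + 1 on, exactly one term survives and the integrals are constant. *)
split => //; apply: (ccvg_uniq hc) => e e0; exists n.+1 => N nN.
rewrite uE (bigD1 (Ordinal nN)) //= eqxx big1 ?addr0.
  by rewrite mulrC subrr cabs0.
move=> k; rewrite -val_eqE /= => /negbTE ->; exact: mulr0.
Qed.

Lemma psum_coef_uniq c d r h : 0 < r -> psum c r h -> psum d r h -> c =1 d.
Proof.
move=> r0 hc hd n; pose z : C := (r / 2)%:C%C.
have zr : cabs z < r by rewrite cabs_real ger0_norm; lra.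
have [_ h1] := expi_coef_integral n hc zr.
have [_ h2] := expi_coef_integral n hd zr.
have p0 : ((pi *+ 2)%:C%C : C) != 0.
  by rewrite -cabs_eq0 cabs_real normr_eq0 gt_eqF // pi2_gt0.
have z0 : z ^+ n != 0.
  by rewrite expf_neq0 // -cabs_eq0 cabs_real normr_eq0 gt_eqF // divr_gt0.
by move: h2; rewrite h1 => /(mulfI p0) /(mulIf z0).
Qed.

Lemma cauchy_estimate c r h rho M n : psum c r h -> 0 <= rho < r ->
  (forall w, cabs w = rho -> cabs (h w) <= M) -> cabs (c n) * rho ^+ n <= 2 * M.
Proof.
move=> H /andP[rho0 rhor] hM.
have rE : cabs (rho%:C%C : C) = rho by rewrite cabs_real ger0_norm.
have [|hI hE] := expi_coef_integral (z := rho%:C%C) n H; first by rewrite rE.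
have := cabs_cint02pi_le hI (M := M); rewrite hE !cabsM cabsX rE cabs_real.
rewrite (ger0_norm (ltW (pi2_gt0 R))) => h1.
rewrite -(ler_pM2l (pi2_gt0 R)); apply: (le_trans (h1 _)).
  move=> t; rewrite cabsM cabs_expi mulr1 hM //.
  by rewrite cabsM cabs_expi mulr1 rE.
by rewrite le_eqVlt; apply/orP; left; apply/eqP; ring.
Qed.

Lemma psum_recenter c r s f z w : psum c r (fun u => f (z + u)) ->
  cabs (w - z) + s <= r -> exists d, psum d s (fun u => f (w + u)).
Proof.
move=> H wz; have [b [_ hb]] := psum_reexpand H.
exists (fun k => b k (w - z)) => u us.
have := hb (w - z) u; rewrite addrA subrKC; apply.
by apply: lt_le_trans wz; rewrite ltrD2l.
Qed.

End CauchyCoefficients.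

(** * From local expansions to a single power series on the whole disc *)

Section Globalization.
Variable R : realType.
Local Notation C := (R[i]).
Implicit Types (a c d : nat -> C) (r s : R) (f h : C -> C) (z w : C).
Local Notation ball0 r := [set z : C | cabs z < r].

Lemma expi_near (t e : R) : 0 < e ->
  \forall t' \near t, cabs (expi t' - expi t : C) < e.
Proof.
move=> e0; have e2 := divr_gt0 e0 (ltr0Sn R 1).
near=> t'; apply: (le_lt_trans (cabs_le_ReIm _)).
rewrite ReD ReN ImD ImN /= (splitr e); apply: ltrD; rewrite distrC; near: t'.
  by have /cvgrPdist_lt := @continuous_cos R t; apply.
by have /cvgrPdist_lt := @continuous_sin R t; apply.
Unshelve. all: by end_near. Qed.

(** Near-covering compactness of [-pi, pi] asks for a property that holds, near each angle, for all
    small [e]. For this reason [e] plays two roles at once: radius of the expansions and inverse of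
    the bound. *)
Lemma circle_uniform_expansion f r s : analytic_on (ball0 r) f -> 0 < s < r ->
  exists2 e : R, 0 < e & forall z, cabs z = s -> exists2 c, psum c e (fun w => f (z + w)) &
    forall w, cabs w < e -> cabs (f (z + w)) <= e^-1.
Proof.
move=> fa /andP[s0 sr].
pose P (e : R) (t : R) := exists2 c, psum c e (fun w => f (s%:C%C * expi t + w)) &
    forall w, cabs w < e -> cabs (f (s%:C%C * expi t + w)) <= e^-1.
have zE t : cabs (s%:C%C * expi t) = s.
  by rewrite cabsM cabs_expi mulr1 cabs_real ger0_norm // ltW.
have hP (t0 : R) : \forall t \near t0 & e \near (0:R)^'+, P e t.
  have U0 : cabs (s%:C%C * expi t0) < r by rewrite zE.
  have [r1 [r10 [a ha]]] := fa _ U0.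
  (* The cap r - s keeps the points inside the disc, where the local expansion represents [f]. *)
  pose q := Num.min r1 (r - s).
  have q0 : 0 < q by rewrite lt_min r10 subr_gt0.
  have Hq : psum a q (fun w => f (s%:C%C * expi t0 + w)).
    move=> w; rewrite lt_min => /andP[w1 w2].
    have U1 : cabs (s%:C%C * expi t0 + w) < r.
      by apply: (le_lt_trans (cabsD _ _)); rewrite zE; lra.
    by have := ha _ _ U1; rewrite /pseries_to [_ + w]addrC addrK; apply.
  have [|M hM] := psum_bounded (rho := q / 2) Hq; first by apply/andP; split; lra.
  have M1 : 0 < `|M| + 1 by rewrite ltr_wpDl.
  (* A centre moved by at most q/4 and a radius below q/4 stay within q/2, where [M] bounds [f]. *)
  near=> t e.
  have e0 : 0 < e by near: e; exact: nbhs_right_gt.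
  have eq : e < q / 4 by near: e; apply: nbhs_right_lt; rewrite divr_gt0.
  have eM : e < (`|M| + 1)^-1 by near: e; apply: nbhs_right_lt; rewrite invr_gt0.
  have tt : cabs (s%:C%C * expi t - s%:C%C * expi t0) <= q / 4.
    rewrite -mulrBr cabsM cabs_real (ger0_norm (ltW s0)) mulrC -ler_pdivlMr //.
    by apply: ltW; near: t; apply: expi_near; rewrite !divr_gt0.
  have [|d hd] := psum_recenter (s := e) (w := s%:C%C * expi t) Hq; first by lra.
  exists d => // w /= we.
  have -> : s%:C%C * expi t + w =
    s%:C%C * expi t0 + ((s%:C%C * expi t - s%:C%C * expi t0) + w) by ring.
  apply: (@le_trans _ _ M).
    apply: hM; apply: (le_trans (cabsD _ _)); lra.
  apply: (@le_trans _ _ (`|M| + 1)); first by rewrite (le_trans (ler_norm _)) // lerDl.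
  by rewrite -[leLHS]invrK lef_pV2 ?posrE ?invr_gt0 // ltW.
have /compact_near_coveringP cov := @segment_compact R (- pi) pi.
have [e [e0 he]] : exists e : R, 0 < e /\ `[- pi, pi]%classic `<=` P e.
  have H := cov _ (0:R)^'+ P _ (fun t _ => hP t).
  by near (0:R)^'+ => e; exists e; split; near: e; [exact: nbhs_right_gt|exact: H].
exists e => // z zs; have [t tpi zt] := polar_form z.
by rewrite zt zs; apply: he; rewrite /= in_itv.
Unshelve. all: by end_near. Qed.

Lemma psum_extend f r s a : analytic_on (ball0 r) f -> 0 < s < r -> psum a s f ->
  exists2 s', s < s' & psum a s' f.
Proof.
move=> fa /andP[s0 sr] H.
have [|e e0 he] := circle_uniform_expansion (s := s) fa; first by rewrite s0.
pose e1 := Num.min e s; have e10 : 0 < e1 by rewrite lt_min e0.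
have [e1e e1s] : e1 <= e /\ e1 <= s by rewrite !ge_min !lexx orbT.
(* The margins are chosen so that r1 + e1/8 = s, while the later s' = r1 + e1/4 equals s + e1/8. *)
pose r1 := s - e1 / 8; have r10 : 0 < r1 by rewrite /r1; lra.
have r1s : r1 < s by rewrite /r1; lra.
have expand z : cabs z = r1 ->
    exists2 d, psum d (e1 * 7 / 8) (fun w => f (z + w)) &
      forall w, cabs w < e1 * 7 / 8 -> cabs (f (z + w)) <= e^-1.
  (* [z1] is the radial projection of [z] to the circle of radius [s]; recentring at distance e1/8
     leaves the radius 7 e1 / 8. *)
  move=> zr; pose z1 := (s / r1)%:C%C * z.
  have z1s : cabs z1 = s.
    by rewrite cabsM cabs_real zr ger0_norm ?divfK ?gt_eqF // divr_ge0 // ltW.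
  have zz1 : cabs (z - z1) = e1 / 8.
    have -> : z - z1 = (1 - s / r1)%:C%C * z.
      by rewrite rmorphB /= mulrBl mul1r.
    rewrite cabsM cabs_real zr -{2}(gtr0_norm r10) -normrM mulrBl mul1r.
    rewrite divfK ?gt_eqF // distrC /r1 opprB addrCA subrr addr0 ger0_norm //.
    by rewrite divr_ge0 // ltW.
  have [c hc cM] := he _ z1s.
  have [|d hd] := psum_recenter (s := e1 * 7 / 8) (w := z) hc; first by rewrite zz1; lra.
  exists d => // w we; have -> : z + w = z1 + (z - z1 + w) by ring.
  by apply: cM; apply: (le_lt_trans (cabsD _ _)); rewrite zz1; lra.
have [b [hb bE]] := psum_reexpand H.
(* Within e1/8 of [z] both the series [a] and the expansion coming from the circle represent [f].
   Their coefficients at [z] therefore agree, and Cauchy's estimate applies with the bound 1/e. *)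
have bnd k z : cabs z = r1 -> cabs (b k z) * (e1 / 2) ^+ k <= 2 * e^-1.
  move=> zr; have [d hd dM] := expand _ zr.
  have bd : b^~ z =1 d.
    apply: (psum_coef_uniq (r := e1 / 8) (h := fun w => f (z + w))).
    - by lra.
    - by move=> w we; apply: bE; rewrite zr /r1; lra.
    - by apply: psumW hd; lra.
  rewrite [b k z]bd; apply: (cauchy_estimate (r := e1 * 7 / 8) k hd); first by apply/andP; split; lra.
  by move=> w we; apply: dM; lra.
pose s' := r1 + e1 / 4.
(* The k-th binomial term of |a_m| (r1 + e1/4)^m is at most 4/e times 2^-k: Cauchy's estimate is
   used once around [z] (through [bnd]) and once in the centre, each time with a factor 2. *)
have abnd m : cabs (a m) * s' ^+ m <= 8 * e^-1.
  rewrite /s' exprDn mulr_sumr.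
  apply: (@le_trans _ _ (\sum_(k < m.+1) (4 * e^-1) * (2^-1) ^+ k)).
    apply: ler_sum => -[k km] _ /=.
    have e2k : 0 < (e1 / 2) ^+ k by rewrite exprn_gt0 // divr_gt0.
    have h1 : cabs (shifted_coef k a (m - k)) * r1 ^+ (m - k) <=
        2 * (2 * e^-1 / (e1 / 2) ^+ k).
      apply: (cauchy_estimate (r := s) _ (hb k)); first by rewrite ltW.
      by move=> z zr; rewrite ler_pdivlMr // bnd.
    have -> : e1 / 4 = (e1 / 2) * 2^-1 by field.
    rewrite exprMn -mulr_natl.
    have -> : cabs (a m) * ('C(m, k)%:R * (r1 ^+ (m - k) * ((e1 / 2) ^+ k * 2^-1 ^+ k))) =
       cabs (shifted_coef k a (m - k)) * r1 ^+ (m - k) * (e1 / 2) ^+ k * 2^-1 ^+ k.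
      by rewrite /shifted_coef subnK // cabsM cabs_nat; ring.
    rewrite ler_wpM2r ?exprn_ge0 ?invr_ge0 // -ler_pdivlMr //.
    by apply: (le_trans h1); rewrite le_eqVlt; apply/orP; left; apply/eqP; ring.
  rewrite -mulr_sumr -(big_mkord xpredT (fun k => (2^-1 : R) ^+ k)).
  have hq : 0 <= (2^-1 : R) < 1 by apply/andP; split; lra.
  have p : 0 <= 4 * e^-1 by rewrite mulr_ge0 // invr_ge0 ltW.
  apply: (le_trans (ler_wpM2l p (geometric_tail_le 0 m.+1 hq))).
  by rewrite le_eqVlt; apply/orP; left; apply/eqP; rewrite expr0; field; rewrite gt_eqF.
have s's : s < s' by rewrite /s' /r1; lra.
(* The series converges on the larger disc to some [g]; it remains to see that [g] equals [f] beyond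
   radius [s] too. *)
have [g hg] : exists g, psum a s' g.
  apply: psum_exists => rho /andP[rho0 rhos]; exists (8 * e^-1) => k.
  apply: le_trans (abnd k); apply: ler_wpM2l; first exact: cabs_ge0.
  by apply: lerXn2r; rewrite ?nnegrE ?(ltW rhos) // ltW // (lt_trans rho0).
have gf z : cabs z < s -> g z = f z.
  by move=> zs; apply: ccvg_uniq (H _ zs); apply: hg; apply: lt_trans s's.
exists s' => // z zs'; suff <- : g z = f z by exact: hg.
have [zs|sz] := ltP (cabs z) s; first exact: gf.
have zp : 0 < cabs z by apply: lt_le_trans sz.
(* Around the radial projection [z0] onto the circle of radius [r1], the expansions of [f] and [g]
   have the same coefficients, since the functions agree near [z0]; both expansions reach [z]. *)
pose z0 := (r1 / cabs z)%:C%C * z; pose w := z - z0.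
have z0r : cabs z0 = r1.
  by rewrite cabsM cabs_real ger0_norm ?divfK ?gt_eqF // divr_ge0 // ltW.
have wE : cabs w = cabs z - r1.
  have -> : w = (1 - r1 / cabs z)%:C%C * z by rewrite rmorphB /= mulrBl mul1r.
  rewrite cabsM cabs_real -{2}(gtr0_norm zp) -normrM mulrBl mul1r divfK ?gt_eqF //.
  by rewrite ger0_norm // subr_ge0 ltW // (lt_le_trans r1s).
have zE : z = z0 + w by rewrite /w addrC subrK.
have [d hd dM] := expand _ z0r.
have [b' [_ b'E]] := psum_reexpand hg.
have db' : d =1 b'^~ z0.
  apply: (psum_coef_uniq (r := e1 / 8) (h := fun w => f (z0 + w))).
  - by lra.
  - by apply: psumW hd; lra.
  move=> u ue; have u1 : cabs z0 + cabs u < s by rewrite z0r /r1; lra.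
  rewrite -gf; last exact: le_lt_trans (cabsD _ _) u1.
  by apply: b'E; apply: lt_trans s's.
have w1 : cabs z0 + cabs w < s' by rewrite z0r wE addrC subrK.
rewrite zE; apply: (ccvg_uniq (b'E _ _ w1)).
have w2 : cabs w < e1 * 7 / 8 by move: w1; rewrite z0r /s'; lra.
by apply: ccvg_ext (hd _ w2) => n; apply: eq_bigr => k _; rewrite db'.
Qed.

(** The series at 0 represents [f] up to the supremum of the admissible radii; were that supremum
    below [r], [psum_extend] would exceed it. *)
Lemma analytic_psum f r : 0 < r -> analytic_on (ball0 r) f -> exists a, psum a r f.
Proof.
move=> r0 fa; have [|r1 [r10 [a ha]]] := fa 0; first by rewrite /mkset cabs0.
exists a; pose S := [set s | 0 < s /\ psum a s f].
have Sm : S (Num.min r1 r).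
  split; first by rewrite lt_min r10.
  move=> w; rewrite lt_min => /andP[w1 w2].
  by have := ha w; rewrite /pseries_to subr0; apply.
apply: contrapT => nH.
have Sr : ubound S r.
  move=> s [s0 hs]; rewrite leNgt; apply/negP => rs; apply: nH.
  by apply: psumW hs; exact: ltW.
have S0 : S !=set0 by exists (Num.min r1 r).
have hS : has_sup S by split => //; exists r.
have supS : psum a (sup S) f.
  by move=> w /(sup_gt S0)[s [s0 hs] ws]; exact: hs.
have sup0 : 0 < sup S.
  by apply: lt_le_trans (sup_upper_bound hS Sm); rewrite lt_min r10.
have [rs|sr] := leP r (sup S); first by apply: nH; exact: psumW rs supS.
have [|s' ss' hs'] := psum_extend fa _ supS; first by rewrite sup0.
have : S s' by split => //; exact: lt_trans ss'.
by move/(sup_upper_bound hS); rewrite leNgt ss'.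
Qed.

End Globalization.

(** * The limsup in terms of eventual bounds *)

Section LimsupCharacterization.
Variable R : realType.

(** This is the form in which growth rates are compared. Since [sigma] is positive, the thresholds
    below it can be taken positive, as suits the majorants. *)
Lemma limf_esup_EFinP (T : choiceType) (X : filteredType T) (F : set_system X) (FF : Filter F)
  (g : X -> R) (sigma : R) : 0 < sigma ->
  limf_esup (fun x => (g x)%:E) F = sigma%:E <->
  (forall s, sigma < s -> \forall x \near F, g x <= s) /\
  (forall s, 0 < s < sigma -> ~ \forall x \near F, g x <= s).
Proof.
move=> sigma0; rewrite /limf_esup; split => [E|[H1 H2]].
  split => [s sigmas|s /andP[s0 ssigma] near_s].
    have [|_ [V FV <-] Vs] := @ereal_inf_lt _
      [set ereal_sup ((fun x => (g x)%:E) @` V) | V in F] s%:E.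
      by rewrite E lte_fin.
    apply: filterS FV => x Vx; rewrite -lee_fin; apply: le_trans (ltW Vs).
    by apply: ereal_sup_ubound; exists x.
  have : (ereal_inf [set ereal_sup ((fun x => (g x)%:E) @` V) | V in F] <= s%:E)%E.
    apply: ge_ereal_inf; exists (ereal_sup ((fun x => (g x)%:E) @` [set x | g x <= s])).
      by exists [set x | g x <= s].
    by apply: ge_ereal_sup => _ [x gx <-]; rewrite lee_fin.
  by rewrite E lee_fin leNgt ssigma.
apply/eqP; rewrite eq_le; apply/andP; split.
  apply/lee_addgt0Pr => e e0; apply: ge_ereal_inf.
  exists (ereal_sup ((fun x => (g x)%:E) @` [set x | g x <= sigma + e])).
    by exists [set x | g x <= sigma + e] => //; apply: H1; rewrite ltrDl.
  by apply: ge_ereal_sup => _ [x gx <-]; rewrite -EFinD lee_fin.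
apply: le_ereal_inf_tmp => _ [V FV <-]; rewrite leNgt; apply/negP => lt_sigma.
have [s [s0 ssigma gs]] : exists s, [/\ 0 < s, s < sigma &
    (ereal_sup ((fun x => (g x)%:E) @` V) <= s%:E)%E].
  case: (ereal_sup _) lt_sigma => [y| |] //=.
    (* The maximum with sigma / 2 keeps the separating level positive. *)
    rewrite lte_fin => ys; exists (Num.max ((y + sigma) / 2) (sigma / 2)).
    by rewrite lt_max gt_max lee_fin le_max; split; lra.
  by move=> _; exists (sigma / 2); rewrite leNye; split => //; lra.
apply: (H2 s); rewrite ?s0 //; apply: filterS FV => x Vx.
by rewrite -lee_fin; apply: le_trans gs; apply: ereal_sup_ubound; exists x.
Qed.

End LimsupCharacterization.

(** * The extremal coefficient bound belonging to the growth exp(s r^rho) *)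

Section Majorant.
Variables (R : realType) (rho : R).
Hypothesis rho0 : 0 < rho.
Implicit Types (s x r : R) (n : nat).

Lemma powR_pinfty_ge (p K : R) : 0 < p -> \forall r \near +oo, K <= r `^ p.
Proof.
move=> p0; near=> r.
have [K0|K0] := leP K 0; first by apply: le_trans K0 _; exact: powR_ge0.
have rK : K `^ p^-1 <= r by near: r; apply: nbhs_pinfty_ge; exact: num_real.
rewrite -[leLHS](powRr1 (ltW K0)) -(mulVf (lt0r_neq0 p0)) powRrM.
by rewrite ge0_ler_powR ?nnegrE ?powR_ge0 ?(ltW p0) // (le_trans _ rK) // powR_ge0.
Unshelve. all: by end_near. Qed.

(** For positive s and n this is the minimum over r > 0 of exp(s r^rho) / r^n, by [majorantM_le] and
    [majorant_attained]. At n = 0 the exponent 0 gives the value 1 in spite of the division by 0. *)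
Definition majorant s n : R := (expR 1 * rho * s / n%:R) `^ (n%:R / rho).

Lemma majorant_gt0 s n : 0 < s -> 0 < majorant s n.
Proof.
move=> s0; case: n => [|n]; first by rewrite /majorant mul0r powRr0.
by rewrite powR_gt0 // !mulr_gt0 ?expR_gt0 // invr_gt0 ltr0n.
Qed.

(** The powers with exponents rho/n and n/rho are monotone and inverse to each other, which turns
    the rate inside the limsup into a bound by [majorant]. *)
Lemma majorant_rate_le s x n : 0 < s -> 0 <= x -> (0 < n)%N ->
  (n%:R / (expR 1 * rho) * x `^ (rho / n%:R) <= s) = (x <= majorant s n).
Proof.
move=> s0 x0 n0; have n0' : 0 < n%:R :> R by rewrite ltr0n.
have e0 := expR_gt0 (1 : R).
have c0 : 0 < expR 1 * rho * s / n%:R by rewrite divr_gt0 // !mulr_gt0.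
have -> : (n%:R / (expR 1 * rho) * x `^ (rho / n%:R) <= s) =
    (x `^ (rho / n%:R) <= expR 1 * rho * s / n%:R).
  rewrite [_ * x `^ _]mulrC -ler_pdivlMr ?divr_gt0 ?mulr_gt0 //.
  by congr (_ <= _); rewrite invf_div; field; rewrite ?gt_eqF.
have inv y : 0 <= y -> (y `^ (rho / n%:R)) `^ (n%:R / rho) = y.
  move=> y0; rewrite -powRrM [X in y `^ X](_ : _ = 1) ?powRr1 //.
  by field; rewrite !gt_eqF.
have inv' y : 0 <= y -> (y `^ (n%:R / rho)) `^ (rho / n%:R) = y.
  move=> y0; rewrite -powRrM [X in y `^ X](_ : _ = 1) ?powRr1 //.
  by field; rewrite !gt_eqF.
apply/idP/idP => h.
  rewrite -(inv x x0) /majorant ge0_ler_powR ?nnegrE ?powR_ge0 ?(ltW c0) //.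
  by rewrite divr_ge0 // ltW.
rewrite -[leRHS](inv' _ (ltW c0)) ge0_ler_powR ?nnegrE ?powR_ge0 //.
by rewrite divr_ge0 // ltW.
Qed.

(** With x = n / rho and u = s r^rho / x, the inequality for n > 0 is the x-th power of e u <= exp
    u, which follows from 1 + ln u <= u. *)
Lemma majorantM_le s r n : 0 < s -> 0 < r -> majorant s n * r ^+ n <= expR (s * r `^ rho).
Proof.
move=> s0 r0; have y0 : 0 < s * r `^ rho by rewrite mulr_gt0 // powR_gt0.
case: n => [|n].
  by rewrite /majorant mul0r powRr0 expr0 mulr1 -expR0 ler_expR ltW.
set m := n.+1; have m0 : 0 < m%:R :> R by rewrite ltr0n.
pose x := m%:R / rho; have x0 : 0 < x by rewrite divr_gt0.
pose u := s * r `^ rho / x; have u0 : 0 < u by rewrite divr_gt0.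
have -> : r ^+ m = (r `^ rho) `^ x.
  by rewrite -powRrM /x mulrCA divff ?mulr1 ?powR_mulrn ?(ltW r0) // gt_eqF.
rewrite /majorant -powRM ?powR_ge0 //; last first.
  by rewrite divr_ge0 ?ler0n // !mulr_ge0 ?expR_ge0 // ltW.
have -> : expR 1 * rho * s / m%:R * r `^ rho = expR 1 * u.
  by rewrite /u /x; field; rewrite !gt_eqF.
have h : expR 1 * u <= expR u.
  rewrite -{1}[u]lnK ?posrE // -expRD ler_expR.
  by rewrite -[leRHS]lnK ?posrE //; exact: expR_ge1Dx.
have -> : s * r `^ rho = u * x by rewrite /u divfK // gt_eqF.
rewrite expRM ge0_ler_powR ?nnegrE ?expR_ge0 //; first exact: ltW.
by rewrite mulr_ge0 ?expR_ge0 // ltW.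
Qed.

(** Changing [s] costs exactly a geometric factor. Together with [ratio_powR_lt1], this is how slack
    between two rates absorbs constants and makes series converge. *)
Lemma majorant_ratio s s' n : 0 < s -> 0 < s' ->
  majorant s n = ((s / s') `^ rho^-1) ^+ n * majorant s' n.
Proof.
move=> s0 s'0.
rewrite -powR_mulrn ?powR_ge0 // -powRrM [rho^-1 * _]mulrC /majorant -powRM.
- by congr (_ `^ _); set m := n%:R^-1; field; rewrite gt_eqF.
- by rewrite divr_ge0 // ltW.
by rewrite divr_ge0 ?ler0n // !mulr_ge0 ?expR_ge0 // ltW.
Qed.

Lemma ratio_powR_lt1 s s' : 0 < s < s' -> 0 <= (s / s') `^ rho^-1 < 1.
Proof.
move=> /andP[s0 ss']; rewrite powR_ge0 /=.
apply: (@lt_le_trans _ _ (1 `^ rho^-1)); last by rewrite powR1.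
rewrite gt0_ltr_powR ?nnegrE ?invr_gt0 //.
  by rewrite divr_ge0 // ltW // (lt_trans s0).
by rewrite ltr_pdivrMr ?mul1r // (lt_trans s0).
Qed.

(** The radius solves s rho r^rho = n, the critical equation of s r^rho - n ln r. *)
Lemma majorant_attained s n : 0 < s -> (0 < n)%N ->
  let r := (n%:R / (s * rho)) `^ rho^-1 in
  expR (s * r `^ rho) = majorant s n * r ^+ n.
Proof.
move=> s0 n0 r; have n0' : 0 < n%:R :> R by rewrite ltr0n.
have b0 : 0 <= n%:R / (s * rho) by rewrite divr_ge0 ?mulr_ge0 // ltW.
have -> : r `^ rho = n%:R / (s * rho).
  by rewrite -powRrM mulVf ?powRr1 // gt_eqF.
have -> : r ^+ n = (n%:R / (s * rho)) `^ (n%:R / rho).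
  by rewrite -[LHS]powR_mulrn ?powR_ge0 // -powRrM [rho^-1 * _]mulrC.
rewrite /majorant -powRM //; last first.
  by rewrite divr_ge0 ?ler0n // !mulr_ge0 ?expR_ge0 // ltW.
have -> : expR 1 * rho * s / n%:R * (n%:R / (s * rho)) = expR 1.
  by field; rewrite !gt_eqF.
by rewrite -expRM mul1r; congr expR; field; rewrite !gt_eqF.
Qed.

End Majorant.

(** * Entire functions as everywhere convergent series; the maximum modulus *)

Section EntireSeries.
Variable R : realType.
Local Notation C := (R[i]).
Implicit Types (a : nat -> C) (F : C -> C).

Lemma psum_entire a F : (forall r, psum a r F) -> entire F.
Proof.
move=> H z0 _; exists 1; split => //.
have [b [_ hb]] := psum_reexpand (H (cabs z0 + 1)).
exists (b^~ z0) => z zz _; rewrite /pseries_to.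
by have := hb z0 (z - z0); rewrite subrKC ltrD2l; apply.
Qed.

Lemma entire_psum F : entire F -> exists a, forall r, psum a r F.
Proof.
move=> entF.
have P r : 0 < r -> exists a, psum a r F.
  move=> r0; apply: analytic_psum => // z0 _.
  have [r1 [r10 [a ha]]] := entF z0 I; exists r1; split => //.
  by exists a => z zz _; exact: ha.
have [a ha] := P 1 ltr01; exists a => r.
(* A radius of at least 1 is positive and covers the unit disc, where uniqueness identifies the
   coefficients with [a]. *)
have r10 : 0 < Num.max r 1 by rewrite lt_max ltr01 orbT.
have [b hb] := P _ r10.
move=> w wr; have <- : b = a.
  apply/funext; apply: (psum_coef_uniq ltr01 _ ha).
  by apply: psumW hb; rewrite le_max lexx orbT.
by apply: hb; rewrite lt_max wr.
Qed.

Lemma maxmod_ge a F z : (forall r, psum a r F) -> cabs (F z) <= maxmod F (cabs z).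
Proof.
move=> H; have [|M hM] := psum_bounded (rho := cabs z) (H (cabs z + 1)).
  by rewrite cabs_ge0 ltrDl ltr01.
have hb : has_ubound [set cabs (F w) | w in [set w | cabs w = cabs z]].
  by exists M => _ [w /= wz <-]; apply: hM; rewrite wz.
by apply: (ub_le_sup hb); exists z.
Qed.

Lemma maxmod_le F r M : 0 <= r -> (forall z, cabs z = r -> cabs (F z) <= M) ->
  maxmod F r <= M.
Proof.
move=> r0 h; have S0 : [set cabs (F z) | z in [set z | cabs z = r]] !=set0.
  by exists (cabs (F r%:C%C)), r%:C%C; rewrite // /mkset cabs_real ger0_norm.
by apply: (ge_sup S0) => _ [z /= zr <-]; exact: h.
Qed.

End EntireSeries.

(** * Type of growth against decay of coefficients *)

Section GrowthType.
Variables (R : realType) (rho : R).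
Hypothesis rho0 : 0 < rho.
Local Notation C := (R[i]).
Local Notation majorant := (majorant rho).
Implicit Types (a : nat -> C) (F : C -> C) (s : R).

Definition type_le F s := \forall r \near +oo, ln (maxmod F r) / r `^ rho <= s.

Definition coef_le a s := \forall n \near \oo, cabs (a n) <= majorant s n.

(** Cauchy's estimate is taken on the circle where the majorant for [s] is attained; its factor 2 is
    absorbed in passing from [s] to [s']. *)
Lemma type_coef_le a F s s' : (forall r, psum a r F) -> 0 < s < s' ->
  type_le F s -> coef_le a s'.
Proof.
move=> H /andP[s0 ss'] [A [_ hA]].
have q01 := ratio_powR_lt1 rho0 (s := s) (s' := s').
rewrite s0 ss' in q01; have {}q01 := q01 isT.
set q := (s / s') `^ rho^-1 in q01.
have s'0 : 0 < s' by apply: lt_trans ss'.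
(* The factor 1 - q cancels the denominator in [geometric_small], leaving 2 q^n < 1. *)
have [N hN] := geometric_small (2 * (1 - q)) q01 ltr01.
near=> n.
have n0 : (0 < n)%N by near: n; exact: nbhs_infty_gt.
have n0' : 0 < n%:R :> R by rewrite ltr0n.
pose r := (n%:R / (s * rho)) `^ rho^-1.
have sr0 : 0 < s * rho by rewrite mulr_gt0.
have r0 : 0 < r by rewrite powR_gt0 // divr_gt0.
have Ar : A < r.
  have A1 : A < `|A| + 1 by rewrite (le_lt_trans (ler_norm _)) // ltrDl.
  apply: (lt_le_trans A1).
  rewrite -[leLHS]powRr1 ?addr_ge0 // -[X in _ `^ X](divff (lt0r_neq0 rho0)) powRrM /r.
  rewrite ge0_ler_powR ?nnegrE ?invr_ge0 ?powR_ge0 ?(ltW rho0) //.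
    by rewrite divr_ge0 // ltW.
  rewrite ler_pdivlMr //; apply: ltW.
  by near: n; exact: nbhs_infty_gtr.
have Mexp : maxmod F r <= expR (s * r `^ rho).
  (* The logarithm can be inverted only where [maxmod] is positive. *)
  have [M0|M0] := leP (maxmod F r) 0; first exact: le_trans M0 (expR_ge0 _).
  rewrite -[leLHS]lnK ?posrE // ler_expR -ler_pdivrMr; first exact: hA.
  exact: powR_gt0.
have aM : cabs (a n) * r ^+ n <= 2 * (majorant s n * r ^+ n).
  rewrite -(majorant_attained rho0 s0 n0) -/r.
  apply: (le_trans _ (ler_wpM2l (ler0n R 2) Mexp)).
  apply: (cauchy_estimate n (H (r + 1))); first by rewrite (ltW r0) ltrDl ltr01.
  by move=> w <-; exact: maxmod_ge.
rewrite mulrA ler_pM2r ?exprn_gt0 // in aM.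
apply: (le_trans aM).
rewrite (majorant_ratio rho0 n s0 s'0) -/q mulrA.
rewrite -[leRHS]mul1r; apply: ler_wpM2r; first exact/ltW/majorant_gt0.
have Nn : (N <= n)%N by near: n; exact: nbhs_infty_ge.
have := hN _ Nn; have q1 : 1 - q != 0 by case/andP: q01 => _ q1; rewrite gt_eqF // subr_gt0.
have -> : 2 * (1 - q) * q ^+ n / (1 - q) = 2 * q ^+ n by field.
exact: ltW.
Unshelve. all: by end_near. Qed.

(** The constant pays for the finitely many exceptional indices. *)
Lemma coef_le_all a s : 0 < s -> coef_le a s ->
  exists2 K, 1 <= K & forall n, cabs (a n) <= K * majorant s n.
Proof.
move=> s0 [N _ hN].
have m0 n : 0 < majorant s n by exact: majorant_gt0.
exists (1 + \sum_(k < N) cabs (a k) / majorant s k) => [|n].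
  by rewrite lerDl sumr_ge0 // => k _; rewrite divr_ge0 ?cabs_ge0 // ltW.
have p k : 0 <= cabs (a k) / majorant s k by rewrite divr_ge0 ?cabs_ge0 // ltW.
rewrite -ler_pdivrMr //; have [nN|Nn] := ltnP n N.
  rewrite (bigD1 (Ordinal nN)) //= addrCA lerDl addr_ge0 // sumr_ge0 //.
apply: (@le_trans _ _ 1); last by rewrite lerDl sumr_ge0.
by rewrite ler_pdivrMr // mul1r; exact: hN.
Qed.

(** By [majorantM_le] the terms are bounded at every radius; the radius |w| + 1 then gives
    convergence at [w]. *)
Lemma coef_le_psum a s : 0 < s -> coef_le a s -> exists F, forall r, psum a r F.
Proof.
move=> s0 /(coef_le_all s0)[K K1 hK].
suff /choice[F hF] : forall w, exists l, ccvg (fun n => \sum_(k < n) a k * w ^+ k) l.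
  by exists F => r w _; exact: hF.
move=> w; pose r := cabs w + 1.
have r0 : 0 < r by rewrite /r ltr_wpDl // cabs_ge0.
apply: (@bounded_coef_cvg _ a (K * expR (s * r `^ rho)) r); last by rewrite /r ltrDl.
move=> n; apply: (le_trans (ler_wpM2r _ (hK n))); first by rewrite exprn_ge0 // ltW.
rewrite -mulrA ler_wpM2l ?majorantM_le //; exact: le_trans K1.
Qed.

(** The slack is spent in two halves: from [s] to [s1] it makes the series of moduli geometric, and
    from [s1] to [s'] it absorbs the constant ln L as r^rho grows. *)
Lemma coef_type_le a F s s' : (forall r, psum a r F) -> 0 < s < s' ->
  coef_le a s -> type_le F s'.
Proof.
move=> H /andP[s0 ss'] /(coef_le_all s0)[K K1 hK].
pose s1 := (s + s') / 2.
have s10 : 0 < s1 by rewrite /s1; lra.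
have ss1 : s < s1 by rewrite /s1; lra.
have [] := andP (@ratio_powR_lt1 _ _ rho0 s s1 _); first by rewrite s0 ss1.
set q := (s / s1) `^ rho^-1 => q0 q1.
pose L := K / (1 - q).
have q1' : 0 < 1 - q by rewrite subr_gt0.
have K0 : 0 <= K by apply: le_trans K1.
have L0 : 0 < L by rewrite divr_gt0 // (lt_le_trans ltr01).
near=> r.
have r0 : 0 < r by near: r; exact: nbhs_pinfty_gt.
have bound : maxmod F r <= L * expR (s1 * r `^ rho).
  apply: (maxmod_le (ltW r0)) => z zr.
  have zr1 : cabs z < r + 1 by rewrite zr ltrDl.
  rewrite -[F z]subr0; apply: (ccvg_bound (N := 0) (H _ _ zr1)) => n _.
  rewrite subr0.
  have := @geometric_tail_bound _ (fun k => a k * z ^+ k)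
    (K * expR (s1 * r `^ rho)) q 0 n _ _ _ (leq0n n).
  rewrite big_ord0 subr0.
  have -> : L * expR (s1 * r `^ rho) = K * expR (s1 * r `^ rho) * q ^+ 0 / (1 - q).
    by rewrite expr0 /L; ring.
  apply.
  - by rewrite q0.
  - by rewrite mulr_ge0 ?expR_ge0.
  move=> k _; rewrite cabsM cabsX zr.
  apply: (le_trans (ler_wpM2r _ (hK k))); first by rewrite exprn_ge0 // ltW.
  rewrite -[leLHS]mulrA -[leRHS]mulrA; apply: ler_wpM2l => //.
  rewrite (majorant_ratio rho0 k s0 s10) -/q -mulrA [leRHS]mulrC.
  by apply: ler_wpM2l; rewrite ?exprn_ge0 // majorantM_le.
rewrite ler_pdivrMr ?powR_gt0 //.
have [M0|M0] := leP (maxmod F r) 0.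
  apply: (@le_trans _ _ 0); first by apply: ln_le0; apply: le_trans M0 _.
  by rewrite mulr_ge0 ?powR_ge0 // ltW // (lt_trans s0).
apply: (@le_trans _ _ (ln (L * expR (s1 * r `^ rho)))).
  by rewrite ler_ln ?posrE // mulr_gt0 // expR_gt0.
rewrite lnM ?posrE ?expR_gt0 // expRK -lerBrDr -mulrBl -ler_pdivrMl; last first.
  by rewrite /s1; lra.
by near: r; exact: powR_pinfty_ge.
Unshelve. all: by end_near. Qed.

(** The type gives ln M(r) <= 2 sigma r^rho eventually, so the order is at most rho. An order below
    rho would give ln M(r) <= r^s for some s < rho, hence a type of at most sigma / 2. *)
Lemma type_order F sigma : 0 < sigma -> type_of F rho = sigma%:E -> order_of F = rho%:E.
Proof.
move=> sigma0 /limf_esup_EFinP[//|up low].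
apply/limf_esup_EFinP => //; split => [s rhos|s /andP[s0 srho] near_s].
  have up2 : \forall r \near +oo, ln (maxmod F r) / r `^ rho <= sigma *+ 2.
    by apply: up; rewrite mulr2n ltrDl.
  have srho : 0 < s - rho by rewrite subr_gt0.
  near=> r.
  have r1 : 1 < r by near: r; exact: nbhs_pinfty_gt.
  have r0 : 0 < r by apply: lt_trans r1.
  have lr0 : 0 < ln r by exact: ln_gt0.
  have s0 : 0 < s by apply: lt_trans rhos.
  rewrite ler_pdivrMr //.
  (* [ln] is at most 0 on all arguments up to 1, nonpositive ones included. *)
  have [M0|M0] := leP (ln (maxmod F r)) 0.
    apply: (@le_trans _ _ 0); first by apply: ln_le0; apply: le_trans M0 _.
    by apply: mulr_ge0; exact: ltW.
  have h : ln (maxmod F r) <= sigma *+ 2 * r `^ rho.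
    by rewrite -ler_pdivrMr ?powR_gt0 //; near: r.
  have c0 : 0 < sigma *+ 2 by rewrite mulrn_wgt0.
  apply: (@le_trans _ _ (ln (sigma *+ 2 * r `^ rho))).
    by rewrite ler_ln ?posrE // mulr_gt0 // powR_gt0.
  rewrite lnM ?posrE ?powR_gt0 // ln_powR -lerBrDr -mulrBl.
  rewrite -[leLHS]expRK -ln_powR ler_ln ?posrE ?expR_gt0 ?powR_gt0 //.
  by near: r; exact: powR_pinfty_ge.
apply: (low (sigma / 2)); first by apply/andP; split; lra.
near=> r.
have r1 : 1 < r by near: r; exact: nbhs_pinfty_gt.
have r0 : 0 < r by apply: lt_trans r1.
have lr0 : 0 < ln r by exact: ln_gt0.
rewrite ler_pdivrMr ?powR_gt0 //.
have h : ln (maxmod F r) <= r `^ s.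
  have [M0|M0] := leP (ln (maxmod F r)) 0; first exact: le_trans M0 (powR_ge0 _ _).
  rewrite -[leLHS]lnK ?posrE // -[leRHS]lnK ?posrE ?powR_gt0 // ler_expR ln_powR.
  by rewrite -ler_pdivrMr //; near: r.
apply: (le_trans h).
have -> : r `^ rho = r `^ (rho - s) * r `^ s.
  by rewrite -powRD ?subrK // (gt_eqF r0) implybT.
rewrite mulrA -[leLHS]mul1r; apply: ler_wpM2r; first exact: powR_ge0.
rewrite -ler_pdivrMl ?divr_gt0 //.
by near: r; apply: powR_pinfty_ge; rewrite subr_gt0.
Unshelve. all: by end_near. Qed.

End GrowthType.

(** * Norm estimates in the space: coefficients, polynomial approximation, monomials *)

Section AdmissibleSpace.
Variables (R : realType) (X : set (R[i] -> R[i])) (Xn : (R[i] -> R[i]) -> R).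
Hypothesis HX : admissible_space X Xn.
Local Notation C := (R[i]).
Local Notation N n := (Xn (fun z : C => z ^+ n)).
Implicit Types (f g : C -> C) (a c : nat -> C).

Let X_analytic f : X f -> analytic_on (@disc R) f.
Proof. by have [h _] := HX; exact: h. Qed.

Let X_ext f g : X f -> (forall z, disc z -> f z = g z) -> X g /\ Xn g = Xn f.
Proof. by have [_ [h _]] := HX; exact: h. Qed.

Let X0 : X (fun=> 0).
Proof. by have [_ [_ [h _]]] := HX. Qed.

Let XD f g : X f -> X g -> X (fun z => f z + g z).
Proof. by have [_ [_ [_ [h _]]]] := HX; exact: h. Qed.

Let XZ (c : C) f : X f -> X (fun z => c * f z).
Proof. by have [_ [_ [_ [_ [h _]]]]] := HX; exact: h. Qed.

Let Xn_ge0 f : X f -> 0 <= Xn f.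
Proof. by have [_ [_ [_ [_ [_ [h _]]]]]] := HX; exact: h. Qed.

Let Xn_eq0 f : X f -> (Xn f = 0 <-> forall z, disc z -> f z = 0).
Proof. by have [_ [_ [_ [_ [_ [_ [h _]]]]]]] := HX; exact: h. Qed.

Let XnZ (c : C) f : X f -> Xn (fun z => c * f z) = cabs c * Xn f.
Proof. by have [_ [_ [_ [_ [_ [_ [_ [h _]]]]]]]] := HX; exact: h. Qed.

Let XnD f g : X f -> X g -> Xn (fun z => f z + g z) <= Xn f + Xn g.
Proof. by have [_ [_ [_ [_ [_ [_ [_ [_ [h _]]]]]]]]] := HX; exact: h. Qed.

Let X_complete (u : nat -> C -> C) : (forall n, X (u n)) ->
  (forall e : R, 0 < e -> exists M : nat, forall m n, (M <= m)%N -> (M <= n)%N ->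
     Xn (fun z => u m z - u n z) < e) ->
  exists v, X v /\ forall e : R, 0 < e -> exists M : nat, forall n, (M <= n)%N ->
     Xn (fun z => u n z - v z) < e.
Proof. by have [_ [_ [_ [_ [_ [_ [_ [_ [_ [h _]]]]]]]]]] := HX; exact: h. Qed.

Let X_entire f : entire f -> X f.
Proof. by have [_ [_ [_ [_ [_ [_ [_ [_ [_ [_ [_ [h _]]]]]]]]]]]] := HX; exact: h. Qed.

Let X_convolution f (g : R -> C) : X f -> L1_02pi g ->
  let h := fun z => (pi *+ 2)^-1%:C%C * cint02pi (fun t => f (z * expi t) * g t) in
  X h /\ Xn h <= (pi *+ 2)^-1 *
    Rintegral lebesgue_measure `[0, pi *+ 2]%classic (fun t => cabs (g t)) * Xn f.
Proof. by have [_ [_ [_ [_ [_ [_ [_ [_ [_ [_ [_ [_ h]]]]]]]]]]]] := HX; exact: h. Qed.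

Lemma space_sub f g : X f -> X g -> X (fun z => f z - g z).
Proof.
move=> Xf Xg; have := XD Xf (XZ (-1) Xg).
by rewrite (_ : (fun z => _ + _) = fun z => f z - g z) //; apply/funext => z; rewrite mulN1r.
Qed.

Lemma norm_subC f g : X f -> X g -> Xn (fun z => f z - g z) = Xn (fun z => g z - f z).
Proof.
move=> Xf Xg; have := XnZ (-1) (space_sub Xg Xf).
rewrite cabsN cabs1 mul1r => <-; congr Xn.
by apply/funext => z; rewrite mulN1r opprB.
Qed.

Lemma norm_triangle f g h : X f -> X g -> X h ->
  Xn (fun z => f z - h z) <= Xn (fun z => f z - g z) + Xn (fun z => g z - h z).
Proof.
move=> Xf Xg Xh; have := XnD (space_sub Xf Xg) (space_sub Xg Xh).
by under [X in Xn X <= _]eq_fun do rewrite subrKA.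
Qed.

Lemma psum_horner (p : {poly C}) r : psum (fun k => p`_k) r (fun z => p.[z]).
Proof.
move=> w _ e e0; exists (size p) => n pn.
by rewrite (horner_coef_wide _ pn) subrr cabs0.
Qed.

Lemma space_poly (p : {poly C}) : X (fun z => p.[z]).
Proof. by apply: X_entire; apply: psum_entire => r; exact: psum_horner. Qed.

Lemma space_monomial n : X (fun z => z ^+ n).
Proof.
rewrite (_ : (fun z => _) = fun z => ('X^n : {poly C}).[z]); first exact: space_poly.
by apply/funext => z; rewrite hornerXn.
Qed.

Lemma norm_monomial_gt0 n : 0 < N n.
Proof.
rewrite lt_neqAle Xn_ge0 ?andbT; last exact: space_monomial.
have h2 : cabs ((2^-1)%:C%C : C) = 2^-1 by rewrite cabs_real ger0_norm.
have d2 : disc ((2^-1)%:C%C : C) by rewrite /disc /mkset h2; lra.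
apply/eqP => /esym /(Xn_eq0 (space_monomial n)) /(_ _ d2)/eqP; rewrite -cabs_eq0 cabsX h2 expf_eq0 invr_eq0.
by rewrite pnatr_eq0 andbF.
Qed.

(* Convolving f with e^{-int} isolates the n-th term of its power series. *)
Lemma coef_norm_le f a n : X f -> psum a 1 f -> cabs (a n) * N n <= Xn f.
Proof.
move=> Xf Hf; have Lg : L1_02pi (fun t : R => expi (- n%:R * t)) by exact: L1_expi.
have [Xh hn] := X_convolution Xf Lg.
have pi0 : (pi : R) *+ 2 != 0 by rewrite gt_eqF // pi2_gt0.
have [|_ E] := X_ext (g := fun z => a n * z ^+ n) Xh.
  move=> z zd; have [_ ->] := expi_coef_integral n Hf zd.
  by rewrite mulrA -rmorphM mulVf // rmorph1 mul1r.
rewrite -XnZ; last exact: space_monomial.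
rewrite E; apply: (le_trans hn).
rewrite [X in _ * X * _](_ : _ = pi *+ 2) ?mulVf ?mul1r //.
rewrite [LHS](_ : _ = Rintegral lebesgue_measure `[0, pi *+ 2]%classic (fun=> 1)).
  by rewrite Rintegral_cst // [X in fine X]measure_02pi mul1r.
by apply: eq_Rintegral => t _; rewrite cabs_expi.
Qed.

Lemma psum_sub_poly f a (p : {poly C}) : psum a 1 f ->
  psum (fun k => a k - p`_k) 1 (fun z => f z - p.[z]).
Proof.
move=> Hf w w1; have h := ccvgMl (-1) (psum_horner p w1).
rewrite -[- p.[w]]mulN1r; apply: ccvg_ext (ccvgD (Hf w w1) h) => n /=.
rewrite mulr_sumr -big_split /=; apply: eq_bigr => k _; ring.
Qed.

(** Subtracting a polynomial of size at most [n] leaves the n-th coefficient untouched, so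
    [coef_norm_le] applies to every competitor in the infimum. *)
Lemma coef_norm_le_best_approx f a n : X f -> psum a 1 f ->
  cabs (a n) * N n <= best_approx Xn n f.
Proof.
move=> Xf Hf; apply: lb_le_inf.
  by exists (Xn (fun z => f z - (0 : {poly C}).[z])), 0 => //=; rewrite size_poly0.
move=> _ [p /= pn <-]; have Xp := space_sub Xf (space_poly p).
have := coef_norm_le n Xp (psum_sub_poly p Hf).
by rewrite nth_default // subr0.
Qed.

Lemma best_approx_le f (p : {poly C}) n : X f -> (size p <= n)%N ->
  best_approx Xn n f <= Xn (fun z => f z - p.[z]).
Proof.
move=> Xf pn; apply: ge_inf; last by exists p.
by exists 0 => _ [q /= _ <-]; apply: Xn_ge0; apply: space_sub => //; exact: space_poly.
Qed.

Lemma best_approx_ge0 f n : X f -> 0 <= best_approx Xn n f.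
Proof.
move=> Xf; apply: lb_le_inf.
  by exists (Xn (fun z => f z - (0 : {poly C}).[z])), 0 => //=; rewrite size_poly0.
by move=> _ [q /= _ <-]; apply: Xn_ge0; apply: space_sub => //; exact: space_poly.
Qed.

Lemma partial_sum_poly c n :
  (fun z : C => \sum_(k < n) c k * z ^+ k) = (fun z => (\poly_(k < n) c k).[z]).
Proof. by apply/funext => z; rewrite horner_poly. Qed.

Lemma space_partial_sum c n : X (fun z => \sum_(k < n) c k * z ^+ k).
Proof. by rewrite partial_sum_poly; exact: space_poly. Qed.

Lemma norm_partial_sum_le c m n : (m <= n)%N ->
  Xn (fun z => \sum_(k < n) c k * z ^+ k - \sum_(k < m) c k * z ^+ k) <=
  \sum_(m <= k < n) cabs (c k) * N k.
Proof.
move=> mn; rewrite -(subnKC mn); elim: (n - m)%N => [|d IH].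
  rewrite addn0 big_geq //; rewrite (_ : (fun z => _) = fun=> 0).
    by rewrite (Xn_eq0 X0).2.
  by apply/funext => z; rewrite subrr.
rewrite addnS big_nat_recr ?leq_addr //=.
apply: (le_trans (norm_triangle (space_partial_sum c _) (space_partial_sum c (m + d))
  (space_partial_sum c _))).
rewrite addrC; apply: lerD => //; rewrite -XnZ; last exact: space_monomial.
rewrite le_eqVlt; apply/orP; left; apply/eqP; congr Xn.
by apply/funext => z; rewrite big_ord_recr /= addrAC subrr add0r.
Qed.

(** Completeness yields a limit [v]. Its Taylor coefficients are the [c k] because [coef_norm_le]
    makes each coefficient continuous in norm. *)
Lemma geometric_norm_cvg c (B q : R) m : 0 <= q < 1 -> 0 <= B ->
  (forall k, (m <= k)%N -> cabs (c k) * N k <= B * q ^+ k) ->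
  exists v, [/\ X v, psum c 1 v &
    Xn (fun z => v z - \sum_(k < m) c k * z ^+ k) <= B * q ^+ m / (1 - q)].
Proof.
move=> hq B0 hc; pose S n := fun z : C => \sum_(k < n) c k * z ^+ k.
have XS n : X (S n) by exact: space_partial_sum.
have tail i j : (m <= i)%N -> (i <= j)%N ->
    Xn (fun z => S j z - S i z) <= B * q ^+ i / (1 - q).
  move=> mi ij; apply: (le_trans (norm_partial_sum_le c ij)).
  rewrite -mulrA; apply: le_trans (ler_wpM2l B0 (geometric_tail_le i j hq)).
  rewrite mulr_sumr big_nat [leRHS]big_nat; apply: ler_sum => k /andP[ik _].
  by apply: hc; exact: leq_trans ik.
have [|v [Xv hv]] := X_complete XS.
  move=> e e0; have [M hM] := geometric_small B hq e0.
  exists (maxn m M) => i j; rewrite !geq_max => /andP[mi Mi] /andP[mj Mj].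
  have [ij|/ltnW ji] := leqP i j.
    by rewrite norm_subC //; apply: le_lt_trans (tail _ _ mi ij) (hM _ Mi).
  exact: le_lt_trans (tail _ _ mj ji) (hM _ Mj).
have [b hb] := analytic_psum ltr01 (X_analytic Xv).
have bc : b = c.
  apply/funext => k; apply/eqP; rewrite -subr_eq0 -cabs_eq0.
  have Nk := norm_monomial_gt0 k.
  suff : cabs (b k - c k) * N k <= 0.
    by rewrite pmulr_lle0 // eq_le cabs_ge0 andbT.
  apply/ler_addgt0Pl => e e0; rewrite addr0.
  have [M hM] := hv _ e0; pose n := maxn M k.+1.
  have kn : (k < n)%N by exact: leq_maxr.
  have := hM n (leq_maxl _ _); rewrite norm_subC // => /ltW; apply: le_trans.
  rewrite (partial_sum_poly c n : S n = _).
  have := coef_norm_le k (space_sub Xv (space_poly (\poly_(i < n) c i)))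
    (psum_sub_poly (\poly_(i < n) c i) hb).
  by rewrite coef_poly kn.
exists v; split => //; first by rewrite -bc.
apply/ler_addgt0Pl => e e0; have [M hM] := hv _ e0.
apply: (le_trans (norm_triangle Xv (XS (maxn m M)) (XS m))); apply: lerD.
  by rewrite norm_subC // ltW // hM // leq_maxr.
by apply: tail => //; exact: leq_maxl.
Qed.

(* Otherwise z^n would decay so fast in norm that a convergent series in X
   could have a sum with radius of convergence less than 1. *)
Lemma norm_monomial_lower : exists2 b : R, 0 < b & \forall n \near \oo, b ^+ n <= N n.
Proof.
(* The n-th term has norm 2^-n, so the series converges in the space. *)
pose c n : C := ((2^-1) ^+ n / N n)%:C%C.
have hq : 0 <= (2^-1 : R) < 1 by apply/andP; split; lra.
have N0 := norm_monomial_gt0.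
have cE n : cabs (c n) = (2^-1) ^+ n / N n.
  by rewrite cabs_real ger0_norm // divr_ge0 ?exprn_ge0 // ltW.
have [|v [_ hv _]] := @geometric_norm_cvg c 1 2^-1 0 hq ler01.
  by move=> k _; rewrite cE divfK ?mul1r // gt_eqF.
have [|B B0 hB] := psum_coef_bounded (rho := 2^-1) hv; first by apply/andP; split; lra.
have [M hM] := geometric_small (B * (1 - 2^-1)) hq ltr01.
(* Boundedness of the terms at radius 1/2 gives 4^-n <= B [N n], and one more factor 2^-n eventually
   outweighs [B]. *)
exists (8^-1); first by rewrite invr_gt0.
exists M => // n /= /hM h; have := hB n; rewrite cE => {}hB.
have e0 : 0 < (2^-1 : R) ^+ n by rewrite exprn_gt0.
have {}h : B * (2^-1) ^+ n <= 1.
  apply: ltW; move: h; suff -> : B * (1 - 2^-1) * 2^-1 ^+ n / (1 - 2^-1) = B * 2^-1 ^+ n by [].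
  by field.
have -> : (8^-1 : R) ^+ n = 2^-1 ^+ n * 2^-1 ^+ n * 2^-1 ^+ n.
  by rewrite -!exprMn; congr (_ ^+ _); field.
rewrite mulrAC ler_pdivrMr // in hB.
apply: (le_trans (ler_wpM2r (ltW e0) hB)).
by rewrite mulrAC -[leRHS]mul1r ler_wpM2r // ltW.
Qed.

End AdmissibleSpace.

(** * Best approximation errors against coefficients *)

Section ApproximationRate.
Variables (R : realType) (X : set (R[i] -> R[i])) (Xn : (R[i] -> R[i]) -> R).
Hypothesis HX : admissible_space X Xn.
Variables (mu rho : R).
Hypothesis Hmu : (fun n => Xn (fun z : R[i] => z ^+ n) `^ (n%:R)^-1) @ \oo --> mu.
Hypothesis rho0 : 0 < rho.
Local Notation C := (R[i]).
Local Notation N n := (Xn (fun z : C => z ^+ n)).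
Local Notation majorant := (majorant rho).

Definition approx_le f s :=
  \forall n \near \oo, best_approx Xn n f / N n <= majorant s n.

Lemma approx_coef_le f a s : X f -> psum a 1 f -> approx_le f s -> coef_le rho a s.
Proof.
move=> Xf Hf h; near=> n; have Nn := norm_monomial_gt0 HX n.
have hn : best_approx Xn n f / N n <= majorant s n by near: n.
by apply: le_trans hn; rewrite ler_pdivlMr // (coef_norm_le_best_approx HX).
Unshelve. all: by end_near. Qed.

Lemma norm_monomial_root n : (0 < n)%N -> (N n `^ (n%:R)^-1) ^+ n = N n.
Proof.
move=> n0; rewrite -powR_mulrn ?powR_ge0 // -powRrM mulVf ?pnatr_eq0 -?lt0n //.
by rewrite powRr1 // ltW // (norm_monomial_gt0 HX).
Qed.

Lemma norm_monomial_rate_gt0 : 0 < mu.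
Proof.
have [b b0 hb] := norm_monomial_lower HX.
apply: (lt_le_trans b0); apply: (cvgr_to_ge Hmu); near=> n.
have n0 : (0 < n)%N by near: n; exact: nbhs_infty_gt.
rewrite -(@ler_pXn2r _ n) ?nnegrE ?powR_ge0 ?(ltW b0) //.
by rewrite norm_monomial_root //; near: n.
Unshelve. all: by end_near. Qed.

Lemma norm_monomial_bounds th : 1 < th ->
  \forall n \near \oo, (mu / th) ^+ n <= N n <= (mu * th) ^+ n.
Proof.
move=> th1; have mu0 := norm_monomial_rate_gt0.
have th0 : 0 < th by apply: lt_trans th1.
have h1 : \forall n \near \oo, N n `^ (n%:R)^-1 < mu * th.
  by apply: (cvgr_lt _ Hmu); rewrite ltr_pMr.
have h2 : \forall n \near \oo, mu / th < N n `^ (n%:R)^-1.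
  by apply: (cvgr_gt _ Hmu); rewrite ltr_pdivrMr // ltr_pMr.
near=> n.
have n0 : (0 < n)%N by near: n; exact: nbhs_infty_gt.
rewrite -[N n]norm_monomial_root //; apply/andP; split.
  apply: lerXn2r; rewrite ?nnegrE ?powR_ge0 ?divr_ge0 ?(ltW mu0) ?(ltW th0) //.
  by apply: ltW; near: n.
apply: lerXn2r; rewrite ?nnegrE ?powR_ge0 ?mulr_ge0 ?(ltW mu0) ?(ltW th0) //.
by apply: ltW; near: n.
Unshelve. all: by end_near. Qed.

(** Freezing the base at index [n] bounds the majorants from [n] on by a geometric sequence. *)
Lemma majorant_root_le s n k : 0 < s -> (0 < n)%N -> (n <= k)%N ->
  majorant s k <= ((expR 1 * rho * s / n%:R) `^ rho^-1) ^+ k.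
Proof.
move=> s0 n0 nk; have L0 : 0 <= expR 1 * rho * s by rewrite !mulr_ge0 ?expR_ge0 // ltW.
rewrite -powR_mulrn ?powR_ge0 // -powRrM [rho^-1 * _]mulrC.
apply: ge0_ler_powR; rewrite ?nnegrE ?divr_ge0 ?(ltW rho0) //.
rewrite ler_wpM2l // lef_pV2 ?posrE ?ltr0n // ?ler_nat //.
exact: leq_trans n0 nk.
Qed.

Lemma majorant_root s n :
  majorant s n = ((expR 1 * rho * s / n%:R) `^ rho^-1) ^+ n.
Proof. by rewrite -powR_mulrn ?powR_ge0 // -powRrM [rho^-1 * _]mulrC. Qed.

(* The loss between s and s' pays for the factor 2 of the geometric tail and for
   replacing norms of monomials by (mu * th) ^+ n and (mu / th) ^+ n. *)
Lemma coef_approx_le f a s s' : X f -> psum a 1 f -> 0 < s < s' ->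
  coef_le rho a s -> approx_le f s'.
Proof.
move=> Xf Hf /andP[s0 ss'] ha.
have s'0 : 0 < s' by apply: lt_trans ss'.
have mu0 := norm_monomial_rate_gt0.
(* The slack (s'/s)^(1/rho) is cut into three factors [th]: for the upper and the lower bound of the
   monomial norms, and for the constant 2. *)
pose th := (s' / s) `^ (3 * rho)^-1.
have th0 : 0 < th by rewrite powR_gt0 // divr_gt0.
have th1 : 1 < th.
  apply: (@le_lt_trans _ _ (1 `^ (3 * rho)^-1)); first by rewrite powR1.
  rewrite gt0_ltr_powR ?nnegrE ?invr_gt0 ?mulr_gt0 ?divr_ge0 ?(ltW s0) ?(ltW s'0) //.
  by rewrite ltr_pdivlMr // mul1r.
have th3 : th ^+ 3 = (s' / s) `^ rho^-1.
  rewrite -powR_mulrn ?powR_ge0 // -powRrM; congr (_ `^ _).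
  by field; rewrite gt_eqF.
have [M1 _ hM1] := norm_monomial_bounds th1.
have [M2 _ hM2] := ha.
pose L := expR 1 * rho * s.
have L0 : 0 < L by rewrite !mulr_gt0 // expR_gt0.
(* A base x <= eps makes the ratio q = x mu th at most 1/2, so that the geometric tail is at most
   twice its first term. *)
pose eps := (2 * (mu * th))^-1.
have eps0 : 0 < eps by rewrite invr_gt0 !mulr_gt0.
have thV : 0 <= th^-1 < 1 by rewrite invr_ge0 ltW //= invf_lt1.
have [M3 hM3] := geometric_small (2 * (1 - th^-1)) thV ltr01.
near=> n.
have n0 : (0 < n)%N by near: n; exact: nbhs_infty_gt.
have n0' : 0 < n%:R :> R by rewrite ltr0n.
have nM1 : (M1 <= n)%N by near: n; exact: nbhs_infty_ge.
have nM2 : (M2 <= n)%N by near: n; exact: nbhs_infty_ge.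
have nM3 : (M3 <= n)%N by near: n; exact: nbhs_infty_ge.
pose x := (L / n%:R) `^ rho^-1.
have x0 : 0 < x by rewrite powR_gt0 // divr_gt0.
have xeps : x <= eps.
  rewrite -[leRHS](powRr1 (ltW eps0)) -(divff (lt0r_neq0 rho0)) powRrM /x.
  apply: ge0_ler_powR; rewrite ?nnegrE ?invr_ge0 ?powR_ge0 ?divr_ge0 ?(ltW rho0) ?(ltW L0) //.
  rewrite ler_pdivrMr // mulrC -ler_pdivrMr ?powR_gt0 //; apply: ltW.
  by near: n; exact: nbhs_infty_gtr.
pose q := x * (mu * th).
have q0 : 0 <= q by rewrite !mulr_ge0 // ltW.
have q2 : q <= 2^-1.
  rewrite /q -ler_pdivlMr ?mulr_gt0 //; apply: (le_trans xeps).
  by rewrite /eps invfM.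
have [||v [Xv hv vle]] := @geometric_norm_cvg _ _ _ HX a 1 q n _ ler01.
- by rewrite q0; lra.
- move=> k nk; rewrite mul1r /q exprMn; have Nk := norm_monomial_gt0 HX k.
  apply: ler_pM; [exact: cabs_ge0|exact: ltW| |].
    apply: (le_trans (hM2 k (leq_trans nM2 nk))).
    exact: majorant_root_le.
  by have /andP[] := hM1 k (leq_trans nM1 nk).
(* Equal Taylor series make [v] and [f] agree on the disc, so the tail estimate for [v] is one for
   [f]. *)
have vf z : disc z -> v z = f z by move=> zd; exact: ccvg_uniq (hv z zd) (Hf z zd).
have En : best_approx Xn n f <= 2 * q ^+ n.
  apply: (le_trans (best_approx_le HX Xf (size_poly n a))).
  have XvS := space_sub HX Xv (space_poly HX (\poly_(k < n) a k)).
  have [_ [ext _]] := HX.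
  have [|_ ->] := ext _ (fun z => f z - (\poly_(k < n) a k).[z]) XvS.
    by move=> z zd; rewrite vf.
  move: vle; rewrite mul1r.
  under eq_fun do rewrite -horner_poly.
  move/le_trans; apply; rewrite mulrC ler_wpM2r ?exprn_ge0 //.
  by rewrite -[leRHS]invrK lef_pV2 ?posrE ?invr_gt0 //; lra.
have /andP[Nlow _] := hM1 n nM1.
rewrite ler_pdivrMr ?norm_monomial_gt0 //; first last.
  exact: (norm_monomial_gt0 HX).
apply: (le_trans En).
have maj0 : 0 <= majorant s' n by apply/ltW/majorant_gt0.
apply: le_trans (ler_wpM2l maj0 Nlow).
rewrite (majorant_ratio rho0 n s'0 s0) majorant_root -/L -/x -th3.
(* One factor [th] cancels the division by [th], one completes [q], and th^n is left to outweigh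
   2. *)
have -> : (th ^+ 3) ^+ n * x ^+ n * (mu / th) ^+ n = th ^+ n * q ^+ n.
  rewrite -!exprMn; congr (_ ^+ _); rewrite /q; field.
  by rewrite gt_eqF.
rewrite ler_wpM2r ?exprn_ge0 //.
have := hM3 n nM3; have th1' : 1 - th^-1 != 0.
  by rewrite gt_eqF // subr_gt0; case/andP: thV.
have -> : 2 * (1 - th^-1) * th^-1 ^+ n / (1 - th^-1) = 2 / th ^+ n.
  by rewrite exprVn mulrAC mulfK.
by rewrite ltr_pdivrMr ?exprn_gt0 // mul1r => /ltW.
Unshelve. all: by end_near. Qed.

Lemma approx_rate_near f s : X f -> 0 < s ->
  (\forall n \near \oo, n%:R / (expR 1 * rho) *
    (best_approx Xn n f / N n) `^ (rho / n%:R) <= s) <-> approx_le f s.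
Proof.
move=> Xf s0.
have E n : (0 < n)%N -> (n%:R / (expR 1 * rho) *
    (best_approx Xn n f / N n) `^ (rho / n%:R) <= s) =
    (best_approx Xn n f / N n <= majorant s n).
  move=> n0; apply: majorant_rate_le => //.
  by rewrite divr_ge0 ?(best_approx_ge0 HX) // ltW // (norm_monomial_gt0 HX).
split=> h; near=> n.
  rewrite -E; first by near: n.
  by near: n; exact: nbhs_infty_gt.
rewrite E; first by near: n.
by near: n; exact: nbhs_infty_gt.
Unshelve. all: by end_near. Qed.

(** Eventual bounds transfer between the two quantities with an arbitrarily small loss ([TE] and
    [ET]), and midpoints between the threshold and [sigma] provide the room for it. *)
Lemma type_limsup_iff f F a sigma : X f -> 0 < sigma -> psum a 1 f ->
  (forall r, psum a r F) ->
  type_of F rho = sigma%:E <->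
  limn_esup (fun n : nat => (n%:R / (expR 1 * rho) *
    (best_approx Xn n f / N n) `^ (rho / n%:R))%:E) = sigma%:E.
Proof.
move=> Xf sigma0 Hf HF.
have TE s s' : 0 < s < s' -> type_le rho F s -> approx_le f s'.
  move=> /andP[s0 ss'] h; pose t := (s + s') / 2.
  apply: (coef_approx_le (s := t) Xf Hf); first by rewrite /t; apply/andP; split; lra.
  by apply: (type_coef_le rho0 HF _ h); rewrite /t; apply/andP; split; lra.
have ET s s' : 0 < s < s' -> approx_le f s -> type_le rho F s'.
  by move=> ss' /(approx_coef_le Xf Hf); exact: coef_type_le.
split=> /limf_esup_EFinP[//|up low]; apply/limf_esup_EFinP => //;
  split => [s sigmas|s /andP[s0 ssigma] h].
- have s0 : 0 < s by apply: lt_trans sigmas.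
  apply: (approx_rate_near Xf s0).2.
  apply: (TE ((sigma + s) / 2)); first by apply/andP; split; lra.
  by apply: up; lra.
- have {}h := (approx_rate_near Xf s0).1 h.
  apply: (low ((s + sigma) / 2)); first by apply/andP; split; lra.
  by apply: ET h; apply/andP; split; lra.
- apply: (ET ((sigma + s) / 2)); first by apply/andP; split; lra.
  have s0 : 0 < (sigma + s) / 2 by lra.
  by apply: (approx_rate_near Xf s0).1; apply: up; lra.
apply: (low ((s + sigma) / 2)); first by apply/andP; split; lra.
have s2 : 0 < (s + sigma) / 2 by lra.
apply: (approx_rate_near Xf s2).2.
by apply: TE h; apply/andP; split; lra.
Unshelve. all: by end_near. Qed.

End ApproximationRate.

Unset Implicit Arguments.

Theorem theorem2p3 (R : realType) (X : set (R[i] -> R[i])) (Xn : (R[i] -> R[i]) -> R)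
  (HX : admissible_space X Xn)
  (mu : R)
  (Hmu : (fun n : nat => Xn (fun z : R[i] => z ^+ n) `^ (n%:R)^-1) @ \oo --> mu)
  (f : R[i] -> R[i]) (Hf : X f) (rho sigma : R) (Hrho : 0 < rho) (Hsigma : 0 < sigma) :
  (exists F : R[i] -> R[i], entire F /\ (forall z, disc z -> F z = f z) /\
     order_of F = rho%:E /\ type_of F rho = sigma%:E)
  <->
  limn_esup (fun n : nat =>
     ((n%:R / (expR 1 * rho)) *
      (best_approx Xn n f / Xn (fun z : R[i] => z ^+ n)) `^ (rho / n%:R))%:E)
  = sigma%:E.
Proof.
split=> [[F [entF [Ff [_ typeF]]]]|limE].
  have [a ha] := entire_psum entF.
  have haf : psum a 1 f by move=> w w1; rewrite -Ff //; exact: (ha 1).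
  exact/(type_limsup_iff HX Hmu Hrho Hf Hsigma haf ha).
have [a ha] := analytic_psum ltr01 (HX.1 f Hf).
have [up _] := (limf_esup_EFinP _ _ Hsigma).1 limE.
(* A bound at a rate above [sigma] already forces enough coefficient decay for the series to
   converge everywhere; the exact type then comes from [type_limsup_iff]. *)
have s2 : sigma < sigma *+ 2 by rewrite mulr2n ltrDl.
have s20 : 0 < sigma *+ 2 by apply: lt_trans s2.
have cle := approx_coef_le HX Hf ha ((approx_rate_near HX Hrho Hf s20).1 (up _ s2)).
have [F hF] := coef_le_psum Hrho s20 cle.
have typeF := (type_limsup_iff HX Hmu Hrho Hf Hsigma ha hF).2 limE.
exists F; split; first exact: psum_entire hF.
split; first by move=> z zd; exact: ccvg_uniq (hF 1 z zd) (ha z zd).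
by split => //; exact: type_order typeF.
Qed.
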